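(* Let $\{x_t\}$ be a sequence generated by AdaUSM (described in the context) applied to $f$, with parameters $\eta>0$, $\epsilon>0$, $0\le\mu<1$, $0\le\lambda\le 1/(1-\mu)$. Assume that the noisy gradients $g_t$ satisfy (A1) $\mathbb{E}_t[g_t]=\nabla f(x_t)$ and (A2) $\mathbb{E}_t\|g_t\|^2\le\sigma^2$ for all $t$, and that the (positive) weights $\{a_t\}$ are non-decreasing in $t$. Let $\tau$ be drawn uniformly at random from $\{1,2,\dots,T\}$. Then $$\Big(\mathbb{E}\big[\|\nabla f(x_\tau)\|^{4/3}\big]\Big)^{3/2}\le \mathrm{Bound}(T)=\mathcal{O}\Big(\frac{d\log\big(\sum_{t=1}^Ta_t\big)}{\sqrt{T}}\Big),$$ where $$\mathrm{Bound}(T)=\frac{\sqrt{2\epsilon^2+2\sigma^2T}}{T}\left[C_1+C_2\log\Big(1+\frac{\sigma^2}{\epsilon^2}\sum_{t=1}^Ta_t\Big)\right],$$ $$C_1=\frac{2(f(x_1)-f^* )}{(1+\lambda\mu)\eta},\qquad C_2=\frac{2\eta(1+2\lambda)^2Ld}{(1+\lambda\mu)(1-\mu)^3}+\frac{4\sigma d}{1-\mu}.$$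
   Context: Problem: $f:\mathbb{R}^d\to\mathbb{R}$ is differentiable, possibly non-convex, $\nabla f$ is $L$-Lipschitz continuous (with respect to the Euclidean norm $\|\cdot\|$), and $f^*=\inf_{x\in\mathbb{R}^d}f(x)>-\infty$. AdaUSM: given $x_1\in\mathbb{R}^d$, $m_0=0\in\mathbb{R}^d$ and positive weights $a_1,a_2,\dots$, set $\bar a_t=\frac1t\sum_{i=1}^ta_i$. At each step $t=1,2,\dots,T$ a stochastic gradient $g_t\in\mathbb{R}^d$ is sampled, and for each coordinate $k=1,\dots,d$ $$\eta_{t,k}=\frac{\eta}{\sqrt{\frac1{\bar a_t}\sum_{i=1}^ta_ig_{i,k}^2}+\epsilon},\qquad m_{t,k}=\mu m_{t-1,k}-\eta_{t,k}g_{t,k},\qquad x_{t+1,k}=x_{t,k}+m_{t,k}+\lambda\mu(m_{t,k}-m_{t-1,k}).$$ Randomness: $g_t$ is a function of $x_t$ and a random sample $\xi_t$, where $\xi_1,\xi_2,\dots$ are independent; $\tau$ is independent of these samples. $\mathbb{E}_t[\cdot]$ denotes conditional expectation given $g_1,\dots,g_{t-1}$; $\sigma\ge0$ is a constant.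
   Formalization: The weights are normalized by assuming a_1 ≥ 1; without a normalization the stated bound is false, since scaling all weights toward 0 leaves the iterates unchanged but can send Bound(T) to 0 when f(x_1) = f^*. *)

(* Defs.v *)
From HB Require Import structures.
From mathcomp Require Import all_boot all_order all_algebra.
From mathcomp Require Import all_classical all_reals all_analysis.
Import Order.TTheory GRing.Theory Num.Theory.
Import numFieldNormedType.Exports.

Set Implicit Arguments.
Unset Strict Implicit.
Unset Printing Implicit Defensive.

Local Open Scope classical_set_scope.
Local Open Scope ring_scope.

(* The library puts no sigma-algebra on row vectors.  This is the one generated
   by the coordinates, i.e. the Borel sigma-algebra of R^n. *)
Section measurable_rV.
Context {R : realType} (n : nat).

Let coord : 'I_n -> 'rV[R]_n -> R := fun k v => v ord0 k.

Let rV_set0 : g_sigma_preimage coord set0.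
Proof. exact: sigma_algebra0. Qed.

Let rV_setC A : g_sigma_preimage coord A -> g_sigma_preimage coord (~` A).
Proof. exact: sigma_algebraC. Qed.

Let rV_bigcup (F : _^nat) : (forall i, g_sigma_preimage coord (F i)) ->
  g_sigma_preimage coord (\bigcup_i (F i)).
Proof. exact: sigma_algebra_bigcup. Qed.

HB.instance Definition _ := @isMeasurable.Build default_measure_display
  'rV[R]_n (g_sigma_preimage coord) rV_set0 rV_setC rV_bigcup.

End measurable_rV.

(* The library norm `|v| on 'rV_n is the sup norm. *)
Definition enorm {R : realType} {n : nat} (v : 'rV[R]_n) : R :=
  Num.sqrt (\sum_(k < n) v ord0 k ^+ 2).

Definition gradient {R : realType} {n : nat} (f : 'rV[R]_n -> R^o)
    (x : 'rV[R]_n) : 'rV[R]_n :=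
  \row_(k < n) 'D_(delta_mx ord0 k) f x.

Section probability.
Context {d : measure_display} {Omega : measurableType d} {R : realType}.
Variable P : probability Omega R.

Definition sigma_of {d' : measure_display} {S : measurableType d'}
    (X : Omega -> S) : set_system Omega :=
  preimage_set_system setT X measurable.

Definition sigma_family {d' : measure_display} {S : measurableType d'}
    (D : set nat) (X : nat -> Omega -> S) : set_system Omega :=
  <<s \bigcup_(i in D) sigma_of (X i) >>.

Definition mutually_independent {d' : measure_display} {S : measurableType d'}
    (D : set nat) (X : nat -> Omega -> S) : Prop :=
  forall (s : seq nat) (A : nat -> set Omega), uniq s ->
    (forall i, i \in s -> D i /\ sigma_of (X i) (A i)) ->
    P (\bigcap_(i in [set` s]) A i) = (\prod_(i <- s) P (A i))%E.

Definition independent_systems (F G : set_system Omega) : Prop :=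
  forall A B, F A -> G B -> P (A `&` B) = (P A * P B)%E.

(* Y is a version of E[X | F], for F a sub-sigma-algebra of the measurable
   sets of Omega. *)
Definition cond_expectation (F : set_system Omega) (X Y : Omega -> R) : Prop :=
  [/\ P.-integrable setT (EFin \o X),
      P.-integrable setT (EFin \o Y),
      forall B : set R, measurable B -> F (Y @^-1` B) &
      forall A, F A ->
        (\int[P]_(w in A) (Y w)%:E = \int[P]_(w in A) (X w)%:E)%E].

End probability.

Section adausm.
Context {R : realType} {n : nat}.
Variables (eta eps mu lambda : R) (a : nat -> R).

Definition abar (t : nat) : R := (\sum_(1 <= i < t.+1) a i) / t%:R.

Definition adausm_step (g : nat -> 'rV[R]_n) (t : nat) (k : 'I_n) : R :=
  eta / (Num.sqrt ((abar t)^-1 * \sum_(1 <= i < t.+1) a i * g i ord0 k ^+ 2)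
         + eps).

(* g, m, x are one realization of the stochastic gradients, momenta and
   iterates; times are numbered from 1, and x 0, g 0, a 0 play no role. *)
Definition adausm_run (x1 : 'rV[R]_n) (T : nat) (g m x : nat -> 'rV[R]_n) :
    Prop :=
  [/\ x 1%N = x1, m 0%N = 0 &
      forall t (k : 'I_n), (1 <= t <= T)%N ->
        m t ord0 k = mu * m t.-1 ord0 k - adausm_step g t k * g t ord0 k /\
        x t.+1 ord0 k = x t ord0 k + m t ord0 k
                        + lambda * mu * (m t ord0 k - m t.-1 ord0 k)].

End adausm.

Section bound.
Context {R : realType}.
(* Delta stands for f x1 - f^*. *)
Variables (Delta eta eps mu lambda sigma L : R) (a : nat -> R).

Definition adausm_C1 : R := 2 * Delta / ((1 + lambda * mu) * eta).

Definition adausm_C2 (n : nat) : R :=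
  2 * eta * (1 + 2 * lambda) ^+ 2 * L * n%:R
    / ((1 + lambda * mu) * (1 - mu) ^+ 3)
  + 4 * sigma * n%:R / (1 - mu).

Definition adausm_bound (n T : nat) : R :=
  Num.sqrt (2 * eps ^+ 2 + 2 * sigma ^+ 2 * T%:R) / T%:R
  * (adausm_C1
     + adausm_C2 n
       * ln (1 + sigma ^+ 2 / eps ^+ 2 * \sum_(1 <= t < T.+1) a t)).

End bound.

(* Main.v *)
(* Shifting the iterates by c m_(t-1), with c = mu (1 / (1 - mu) - lambda), removes the
   momentum: z_t = x_t + c m_(t-1) satisfies z_(t+1) = z_t - d_t / (1 - mu), where
   d_t is the vector of the eta_(t,k) g_(t,k).  The descent lemma at z_t, the
   Lipschitz bound on grad f(z_t) - grad f(x_t), and a multiple of |m_t|^2 added to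
   f(z_t) give, along every run,

     sum_t <grad f(x_t), d_t> <= (1 - mu) Delta + const * sum_t |d_t|^2,

   and since the weights are non-decreasing the last sum telescopes into logarithms.
   Because eta_(t,k) depends on g_t, it is compared with the step size in which
   g_(t,k)^2 is replaced by sigma^2: this one depends on the past only, and the error
   is half of the main term plus another logarithmic sum.  Taking expectations bounds
   sum_t E[sum_k (d_k f(x_t))^2 u_(t,k)], where u_(t,k) is the surrogate step size
   over eta.  Young's inequality with exponents 3/2 and 3, optimized over its
   parameter only after averaging over t, turns this into the bound on the 4/3-rd
   moment.  The expected logarithm is bounded through a tangent line. *)

Require Import Defs.
From mathcomp Require Import all_boot all_order all_algebra.
From mathcomp Require Import all_classical all_reals all_analysis.
From mathcomp Require Import measurable_realfun ring lra.
Import Order.TTheory GRing.Theory Num.Theory.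
Import numFieldNormedType.Exports.

Set Implicit Arguments.
Unset Strict Implicit.
Unset Printing Implicit Defensive.

Local Open Scope classical_set_scope.
Local Open Scope ring_scope.

(** * Integrals of real functions and conditional expectations *)

Section expectation.
Context {d : measure_display} {Omega : measurableType d} {R : realType}.
Variable P : probability Omega R.
Implicit Types (X Y Z V W : Omega -> R) (A : set Omega) (M s c : R).

(** Real-valued, so that ring and linear arithmetic apply directly. An infinite integral is turned
    into 0, which is why many lemmas below ask for [L1]. *)
Definition mean (X : Omega -> R) : R := \int[P]_w X w.

Definition L1 (X : Omega -> R) : Prop := P.-integrable setT (EFin \o X).

(** Measurability for the sigma-algebra generated by [C], expressed by retyping the domain so that
    the closure lemmas for measurable functions apply unchanged. *)
Definition submeasurable (C : set_system Omega) (Z : Omega -> R) : Prop :=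
  measurable_fun setT (Z : g_sigma_algebraType C -> R).

Lemma L1_measurable X : L1 X -> measurable_fun setT X.
Proof. by move=> /measurable_int /measurable_EFinP. Qed.

Lemma L1_bounded Z M : measurable_fun setT Z -> (forall w, `|Z w| <= M) -> L1 Z.
Proof.
move=> mZ ZM; apply: measurable_bounded_integrable => //.
  by rewrite ltey_eq fin_num_measure.
exists M; split; first exact: num_real.
by move=> x Mx w _; apply: le_trans (ZM w) (ltW Mx).
Qed.

Lemma L1_cst c : L1 (fun=> c).
Proof. by apply: (@L1_bounded _ `|c|). Qed.

Lemma L1D X Y : L1 X -> L1 Y -> L1 (fun w => X w + Y w).
Proof. exact: integrableD. Qed.

Lemma L1B X Y : L1 X -> L1 Y -> L1 (fun w => X w - Y w).
Proof. exact: integrableB. Qed.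

Lemma L1Zl c X : L1 X -> L1 (fun w => c * X w).
Proof. exact: integrableZl. Qed.

Lemma L1Zr c X : L1 X -> L1 (fun w => X w * c).
Proof. by move=> /(L1Zl c); under eq_fun do rewrite mulrC. Qed.

Lemma L1N X : L1 X -> L1 (fun w => - X w).
Proof. exact: integrableN. Qed.

Lemma L1_sum I (s : seq I) (Q : pred I) (X : I -> Omega -> R) :
  (forall i, Q i -> L1 (X i)) -> L1 (fun w => \sum_(i <- s | Q i) X i w).
Proof.
move=> LX; elim: s => [|i s ih].
  by under eq_fun do rewrite big_nil; exact: L1_cst.
under eq_fun do rewrite big_cons.
by case: (boolP (Q i)) => // Qi; apply: L1D => //; exact: LX.
Qed.

Lemma L1M Z M X : measurable_fun setT Z -> (forall w, `|Z w| <= M) -> L1 X ->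
  L1 (fun w => Z w * X w).
Proof.
move=> mZ ZM LX; apply: (@integrableMr _ _ _ _ _ measurableT Z (EFin \o X)) => //.
exists M; split; first exact: num_real.
by move=> x Mx w _; apply: le_trans (ZM w) (ltW Mx).
Qed.

Lemma L1_le X Y : measurable_fun setT X -> (forall w, `|X w| <= Y w) ->
  L1 Y -> L1 X.
Proof.
move=> mX XY; apply: le_integrable => //; first exact/measurable_EFinP.
by move=> w _; rewrite lee_fin (le_trans (XY w)) // ler_norm.
Qed.

Lemma meanD X Y : L1 X -> L1 Y -> mean (fun w => X w + Y w) = mean X + mean Y.
Proof. exact: RintegralD. Qed.

Lemma meanB X Y : L1 X -> L1 Y -> mean (fun w => X w - Y w) = mean X - mean Y.
Proof. exact: RintegralB. Qed.

Lemma meanZl c X : L1 X -> mean (fun w => c * X w) = c * mean X.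
Proof. exact: RintegralZl. Qed.

Lemma meanZr c X : L1 X -> mean (fun w => X w * c) = mean X * c.
Proof. exact: RintegralZr. Qed.

Lemma mean_cst c : mean (fun=> c) = c.
Proof.
rewrite /mean Rintegral_cst // (_ : fine _ = 1) ?mulr1 //.
exact: (congr1 fine (probability_setT P)).
Qed.

Lemma mean_sum I (s : seq I) (Q : pred I) (X : I -> Omega -> R) :
  (forall i, Q i -> L1 (X i)) ->
  mean (fun w => \sum_(i <- s | Q i) X i w) = \sum_(i <- s | Q i) mean (X i).
Proof.
move=> LX; elim: s => [|i s ih].
  by under [X in mean X]eq_fun do rewrite big_nil; rewrite mean_cst big_nil.
under [X in mean X]eq_fun do rewrite big_cons.
rewrite big_cons; case: ifP => // Qi.
by rewrite meanD ?ih //; [exact: LX|exact: L1_sum].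
Qed.

Lemma mean_ge0 X : (forall w, 0 <= X w) -> 0 <= mean X.
Proof. by move=> X0; apply: Rintegral_ge0 => w _. Qed.

Lemma le_mean X Y : L1 X -> L1 Y -> (forall w, X w <= Y w) ->
  mean X <= mean Y.
Proof. by move=> LX LY XY; apply: le_Rintegral. Qed.

Lemma integral_mean X : L1 X -> (\int[P]_w (X w)%:E)%E = (mean X)%:E.
Proof. by move=> LX; rewrite /mean fineK //; exact: integrable_fin_num. Qed.

Lemma ae_eq_integral_EFin X Y : measurable_fun setT X -> measurable_fun setT Y ->
  {ae P, forall w, X w = Y w} -> (\int[P]_w (X w)%:E = \int[P]_w (Y w)%:E)%E.
Proof.
move=> mX mY XY; apply: ae_eq_integral => //; try exact/measurable_EFinP.
by apply: filterS XY => w ->.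
Qed.

Lemma ae_eq_mean X Y : measurable_fun setT X -> measurable_fun setT Y ->
  {ae P, forall w, X w = Y w} -> mean X = mean Y.
Proof. by move=> mX mY XY; congr fine; exact: ae_eq_integral_EFin. Qed.

(** [Y] agrees almost everywhere with the maximum of [X] and [Y], which dominates [X] everywhere. *)
Lemma ae_le_mean X Y : L1 X -> L1 Y -> {ae P, forall w, X w <= Y w} ->
  mean X <= mean Y.
Proof.
move=> LX LY XY.
have mX := L1_measurable LX; have mY := L1_measurable LY.
have mZ : measurable_fun setT (fun w => Num.max (X w) (Y w)).
  exact: measurable_maxr.
have -> : mean Y = mean (fun w => Num.max (X w) (Y w)).
  by apply: ae_eq_mean => //; apply: filterS XY => w XYw; rewrite max_r.
apply: le_mean => // [|w]; last by rewrite le_max lexx.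
apply: (@L1_le _ (fun w => `|X w| + `|Y w|)) => //.
  by move=> w; case: (leP (X w) (Y w)) => _; rewrite ?lerDr ?lerDl normr_ge0.
by apply: L1D; exact: integrable_norm.
Qed.

Lemma ge0_mean0 X : L1 X -> (forall w, 0 <= X w) -> mean X <= 0 ->
  {ae P, forall w, X w = 0}.
Proof.
move=> LX X0 EX.
have mX := L1_measurable LX.
have : ae_eq P setT (EFin \o X) (cst 0%E).
  apply/(ae_eq_integral_abs P measurableT) => //; first exact/measurable_EFinP.
  have h := integrable_fin_num measurableT LX.
  have -> : (\int[P]_x `|(EFin \o X) x|)%E = (\int[P]_x (X x)%:E)%E.
    by apply: eq_integral => w _ /=; rewrite ger0_norm.
  rewrite -[LHS]fineK //; congr EFin; apply/eqP; rewrite eq_le EX /=.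
  exact: mean_ge0.
by apply: filterS => w /(_ I) [].
Qed.

Lemma mean_restrict A X : mean (fun w => \1_A w * X w) = \int[P]_(w in A) X w.
Proof.
rewrite Rintegral_mkcond; apply: eq_Rintegral => w _.
rewrite patchE indicE; case: ifP => _; by rewrite ?mul1r ?mul0r.
Qed.

(** * Conditioning on a generated sigma-algebra *)

Section conditioning.
Variable C : set_system Omega.
Hypothesis Cmeas : <<s C >> `<=` measurable.

Lemma submeasurable_measurable Z : submeasurable C Z -> measurable_fun setT Z.
Proof. by move=> mZ _ B mB; apply: Cmeas; exact: mZ. Qed.

Lemma submeasurable_indic (A : set Omega) : <<s C >> A ->
  submeasurable C (\1_A : Omega -> R).
Proof.
by move=> CA; apply: (@measurable_indic _ (g_sigma_algebraType C)).
Qed.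

Lemma norm_indic_le1 (A : set Omega) w : `|\1_A w : R| <= 1.
Proof. by rewrite indicE; case: (_ \in _); rewrite ?normr1 ?normr0. Qed.

Lemma L1_indicM A X : <<s C >> A -> L1 X -> L1 (fun w => \1_A w * X w).
Proof.
move=> CA; apply: (@L1M _ 1); last exact: norm_indic_le1.
exact: submeasurable_measurable (submeasurable_indic CA).
Qed.

(* Subtracting [M / 2] on the set [{Z >= M / 2}] halves the bound on [Z] without
   changing [E[Z W]]. *)
Lemma mean_mul_halving (W : Omega -> R) : L1 W ->
  (forall A, <<s C >> A -> mean (fun w => \1_A w * W w) = 0) ->
  forall k M Z, submeasurable C Z -> (forall w, 0 <= Z w <= M) ->
  `|mean (fun w => Z w * W w)| <= M / 2 ^+ k * mean (fun w => `|W w|).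
Proof.
move=> LW W0; elim=> [|k ih] M Z mZ ZM.
  have bZ w : `|Z w| <= M by have /andP[? ?] := ZM w; rewrite ger0_norm.
  have LZW := L1M (submeasurable_measurable mZ) bZ LW.
  have LnW : L1 (fun w => `|W w|) by exact: integrable_norm.
  rewrite expr0 divr1 -meanZl // /mean.
  apply: le_trans (le_normr_Rintegral _ _) _ => //.
  apply: le_mean => [||w]; [exact: integrable_norm|exact: L1Zl|].
  by rewrite normrM ler_wpM2r.
pose A := [set w | M / 2 <= Z w].
have CA : <<s C >> A.
  have /(_ (measurable_cst _) mZ measurableT [set true] I) :=
    @measurable_fun_ler _ (g_sigma_algebraType C) _ setT (fun=> M / 2) Z.
  by rewrite setTI.
pose Z' w := Z w - M / 2 * \1_A w.
have mZ' : submeasurable C Z'.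
  by apply: measurable_funB => //; apply: measurable_funM => //.
have ZM' w : 0 <= Z' w <= M / 2.
  rewrite /Z' indicE; have /andP[Z0 Z1] := ZM w.
  case: (boolP (w \in A)) => [|/negP]; rewrite inE /A /=.
    by move=> h; apply/andP; split; lra.
  by move=> /negP; rewrite -ltNge => h; apply/andP; split; lra.
have bZ' w : `|Z' w| <= M / 2 by have /andP[? ?] := ZM' w; rewrite ger0_norm.
have LZ' := L1M (submeasurable_measurable mZ') bZ' LW.
have -> : mean (fun w => Z w * W w) = mean (fun w => Z' w * W w).
  rewrite -[RHS]addr0 -(mulr0 (M / 2)) -(W0 A CA) -meanZl; last exact: L1_indicM.
  rewrite -meanD //; last exact/L1Zl/L1_indicM.
  by apply: eq_Rintegral => w _; rewrite /Z'; ring.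
apply: le_trans (ih _ _ mZ' ZM') _.
by rewrite exprS invfM mulrA.
Qed.

(** Adding [M] makes the factor nonnegative and bounded by [2 * M], at no cost because [W] has mean
    0. Halving the bound arbitrarily often then leaves only 0; this replaces an approximation by
    simple functions. *)
Lemma mean_mul_eq0 W Z M : L1 W ->
  (forall A, <<s C >> A -> mean (fun w => \1_A w * W w) = 0) ->
  submeasurable C Z -> (forall w, `|Z w| <= M) ->
  mean (fun w => Z w * W w) = 0.
Proof.
move=> LW W0 mZ ZM.
have M0 : 0 <= M by apply: le_trans (ZM point); exact: normr_ge0.
pose Y w := Z w + M.
have mY : submeasurable C Y by apply: measurable_funD.
have YM w : 0 <= Y w <= 2 * M.
  by have := ZM w; rewrite ler_norml /Y => /andP[? ?]; apply/andP; split; lra.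
have LnW : L1 (fun w => `|W w|) by exact: integrable_norm.
have bY w : `|Y w| <= 2 * M by have /andP[? ?] := YM w; rewrite ger0_norm.
have LYW := L1M (submeasurable_measurable mY) bY LW.
have EW : mean W = 0.
  rewrite -[RHS](W0 setT); last exact: (@measurableT _ (g_sigma_algebraType C)).
  by apply: eq_Rintegral => w _; rewrite indicT mul1r.
have -> : mean (fun w => Z w * W w) = mean (fun w => Y w * W w).
  rewrite -[RHS]subr0 -[in RHS](mulr0 M) -EW -meanZl // -meanB //; last exact: L1Zl.
  by apply: eq_Rintegral => w _; rewrite /Y; ring.
have K0 : 0 <= mean (fun w => `|W w|) by apply: mean_ge0.
apply/eqP; rewrite -normr_le0; apply/ler_addgt0Pr => e e0; rewrite add0r.
pose K := 2 * M * mean (fun w => `|W w|).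
have [k kP] : exists k, K / e < 2 ^+ k.
  exists (Num.bound (K / e)); apply: lt_trans (archi_boundP _) _.
    by rewrite divr_ge0 ?(ltW e0) // /K; do 2 apply: mulr_ge0 => //.
  by rewrite -natrX ltr_nat ltn_expl.
apply: le_trans (mean_mul_halving LW W0 k mY YM) _.
rewrite ltr_pdivrMr // in kP.
rewrite mulrAC ler_pdivrMr ?exprn_gt0 // (mulrC e); exact: ltW kP.
Qed.

(** Taking out what is known, for a bounded factor: [Y] plays the conditional expectation of [X], so
    [X - Y] integrates to 0 over every set of the sigma-algebra. *)
Lemma mean_mul_eq X Y Z M : L1 X -> L1 Y ->
  (forall A, <<s C >> A ->
    mean (fun w => \1_A w * X w) = mean (fun w => \1_A w * Y w)) ->
  submeasurable C Z -> (forall w, `|Z w| <= M) ->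
  mean (fun w => Z w * X w) = mean (fun w => Z w * Y w).
Proof.
move=> LX LY XY mZ ZM; apply/eqP; rewrite -subr_eq0; apply/eqP.
have mZ' := submeasurable_measurable mZ.
rewrite -meanB; [|exact: (L1M mZ' ZM)..].
rewrite -[RHS](@mean_mul_eq0 (fun w => X w - Y w) Z M) //.
- by apply: eq_Rintegral => w _; rewrite mulrBr.
- exact: L1B.
- move=> A CA; rewrite -[RHS](subrr (mean (fun w => \1_A w * Y w))) -{1}XY //.
  rewrite -meanB; [|exact: L1_indicM..].
  by apply: eq_Rintegral => w _; rewrite mulrBr.
Qed.

(** A form of conditional Jensen for the square. By AM-GM, [Y - s] has nonpositive integral over the
    set where [Y] exceeds [s]; since it is positive there, the set is null. *)
Lemma cond_mean_le_ae X Y s : 0 <= s -> L1 X -> L1 (fun w => X w ^+ 2) ->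
  L1 Y -> submeasurable C Y ->
  (forall A, <<s C >> A ->
    mean (fun w => \1_A w * X w) = mean (fun w => \1_A w * Y w)) ->
  (forall A, <<s C >> A ->
    mean (fun w => \1_A w * X w ^+ 2) <= s ^+ 2 * mean (\1_A)) ->
  {ae P, forall w, Y w <= s}.
Proof.
move=> s0 LX LX2 LY mY XY X2.
pose A := [set w | s < Y w].
have CA : <<s C >> A.
  have /(_ (measurable_cst _) mY measurableT [set true] I) :=
    @measurable_fun_ltr _ (g_sigma_algebraType C) _ setT (fun=> s) Y.
  by rewrite setTI.
have L1A : L1 (\1_A).
  by apply: (L1_bounded _ (norm_indic_le1 A)); apply: submeasurable_measurable;
    exact: submeasurable_indic.
have LA V : L1 V -> L1 (fun w => \1_A w * V w) by exact: L1_indicM.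
have EA1 : mean (\1_A) <= 1.
  rewrite -[leRHS]mean_cst; apply: le_mean => //; first exact: L1_cst.
have EA0 : 0 <= mean (\1_A) by apply: mean_ge0 => w; rewrite indicE.
have h : mean (fun w => \1_A w * (Y w - s)) <= 0.
  have -> : mean (fun w => \1_A w * (Y w - s)) =
            mean (fun w => \1_A w * X w) - s * mean (\1_A).
    rewrite XY // -meanZl // -meanB; [|exact: LA|exact: L1Zl].
    by apply: eq_Rintegral => w _; ring.
  apply/ler_addgt0Pr => e e0; rewrite add0r.
  (* The slack [e] keeps [t] positive even when [s = 0], so that one may divide by it. *)
  pose t := s + e; have t0 : 0 < t by rewrite /t; lra.
  (* AM-GM: [X <= t / 2 + X ^+ 2 / (2 t)] *)
  have : mean (fun w => \1_A w * X w) <=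
         mean (fun w => t / 2 * \1_A w + (2 * t)^-1 * (\1_A w * X w ^+ 2)).
    apply: le_mean; [exact: LA|by apply: L1D; apply: L1Zl => //; exact: LA|].
    move=> w; rewrite indicE; case: (_ \in _); last by rewrite !(mulr0,mul0r,addr0).
    rewrite !mul1r mulr1 -subr_ge0.
    have -> : t / 2 + (2 * t)^-1 * X w ^+ 2 - X w = (2 * t)^-1 * (X w - t) ^+ 2.
      by field; rewrite gt_eqF.
    by rewrite mulr_ge0 ?sqr_ge0 // invr_ge0; lra.
  rewrite meanD; [|exact: L1Zl|by apply: L1Zl; exact: LA].
  rewrite !meanZl //; last exact: LA.
  move=> hX.
  have hX2 : (2 * t)^-1 * mean (fun w => \1_A w * X w ^+ 2) <= t / 2 * mean (\1_A).
    have -> : t / 2 = (2 * t)^-1 * t ^+ 2 by field; rewrite gt_eqF.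
    rewrite -mulrA ler_wpM2l ?invr_ge0; first by [].
      by lra.
    apply: le_trans (X2 A CA) _; rewrite ler_wpM2r //.
    by rewrite ler_sqr ?nnegrE /t; lra.
  have : mean (fun w => \1_A w * X w) <= t * mean (\1_A) by lra.
  rewrite /t mulrDl; have : e * mean (\1_A) <= e by rewrite ler_piMr // ltW.
  by lra.
have LYs : L1 (fun w => \1_A w * (Y w - s)).
  by apply: LA; apply: L1B => //; exact: L1_cst.
apply: filterS (ge0_mean0 LYs _ h) => [w|w].
  rewrite indicE; case: (boolP (w \in A)) => [|/negP]; rewrite inE /A /=.
    by move=> _ /eqP; rewrite mul1r subr_eq0 => /eqP ->.
  by move=> /negP; rewrite -leNgt.
rewrite indicE; case: (boolP (w \in A)); rewrite ?mul0r // inE /A /= mul1r.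
by rewrite subr_ge0 => /ltW.
Qed.

Definition clamp (s y : R) : R := Num.max (- s) (Num.min s y).

Lemma norm_clamp_le s y : 0 <= s -> `|clamp s y| <= s.
Proof.
by move=> s0; rewrite ler_norml /clamp le_max lexx ge_max ge_min lexx /= andbT; lra.
Qed.

Lemma clamp_id s y : `|y| <= s -> clamp s y = y.
Proof. by rewrite ler_norml => /andP[? ?]; rewrite /clamp min_r // max_r. Qed.

Lemma submeasurable_clamp s Y : submeasurable C Y ->
  submeasurable C (fun w => clamp s (Y w)).
Proof.
by move=> mY; apply: measurable_maxr => //; apply: measurable_minr.
Qed.

(** The one-sided bound is applied to [X] and to [- X]. The truncation is bounded everywhere and not
    just almost everywhere, so it can serve as a bounded factor. *)
Lemma cond_mean_clamp_ae X Y s : 0 <= s -> L1 X -> L1 (fun w => X w ^+ 2) ->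
  L1 Y -> submeasurable C Y ->
  (forall A, <<s C >> A ->
    mean (fun w => \1_A w * X w) = mean (fun w => \1_A w * Y w)) ->
  (forall A, <<s C >> A ->
    mean (fun w => \1_A w * X w ^+ 2) <= s ^+ 2 * mean (\1_A)) ->
  {ae P, forall w, Y w = clamp s (Y w)}.
Proof.
move=> s0 LX LX2 LY mY XY X2.
have h1 := cond_mean_le_ae s0 LX LX2 LY mY XY X2.
have h2 : {ae P, forall w, - Y w <= s}.
  apply: (@cond_mean_le_ae (fun w => - X w)) => //.
  - exact: L1N.
  - by under eq_fun do rewrite sqrrN.
  - exact: L1N.
  - exact: measurable_funN.
  - move=> A CA.
    have N V : L1 V -> mean (fun w => \1_A w * - V w) = - mean (fun w => \1_A w * V w).
      move=> LV; rewrite -mulN1r -meanZl; last exact: L1_indicM.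
      by apply: eq_Rintegral => w _; ring.
    by rewrite !N // XY.
  - by move=> A CA; under [X in mean X]eq_fun do rewrite sqrrN; exact: X2.
apply: filterS2 h1 h2 => w h1 h2; rewrite clamp_id // ler_norml h1 andbT; lra.
Qed.

End conditioning.
End expectation.

(** * Descent along the momentum iterates *)

Section smooth.
Context {R : realType} {n : nat}.
Implicit Types u v y z : 'rV[R]_n.

Definition dotp u v : R := \sum_(k < n) u ord0 k * v ord0 k.

Definition sqnorm u : R := \sum_(k < n) u ord0 k ^+ 2.

Lemma sqnorm_ge0 u : 0 <= sqnorm u.
Proof. by apply: sumr_ge0 => k _; exact: sqr_ge0. Qed.

Lemma enorm_sqr u : enorm u ^+ 2 = sqnorm u.
Proof. by rewrite sqr_sqrtr // sqnorm_ge0. Qed.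

Lemma enorm_ge0 u : 0 <= enorm u.
Proof. exact: sqrtr_ge0. Qed.

Lemma sqnormZ c u : sqnorm (c *: u) = c ^+ 2 * sqnorm u.
Proof. by rewrite /sqnorm mulr_sumr; apply: eq_bigr => k _; rewrite mxE exprMn. Qed.

Lemma enormZ c u : 0 <= c -> enorm (c *: u) = c * enorm u.
Proof.
move=> c0; rewrite /enorm -/(sqnorm _) sqnormZ sqrtrM ?sqr_ge0 //.
by rewrite sqrtr_sqr ger0_norm.
Qed.

Lemma dotpDl u v y : dotp (u + v) y = dotp u y + dotp v y.
Proof. by rewrite -big_split; apply: eq_bigr => k _; rewrite mxE mulrDl. Qed.

Lemma dotpZr c u v : dotp u (c *: v) = c * dotp u v.
Proof. by rewrite mulr_sumr; apply: eq_bigr => k _; rewrite mxE mulrCA. Qed.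

Lemma dotpNl u v : dotp (- u) v = - dotp u v.
Proof. by rewrite /dotp -sumrN; apply: eq_bigr => k _; rewrite mxE mulNr. Qed.

Lemma dotp_young q u v : 0 < q -> dotp u v <= (q * sqnorm u + q^-1 * sqnorm v) / 2.
Proof.
move=> q0; rewrite /sqnorm !mulr_sumr -big_split mulr_suml; apply: ler_sum => k _ /=.
rewrite -subr_ge0.
have -> : (q * u ord0 k ^+ 2 + q^-1 * v ord0 k ^+ 2) / 2 - u ord0 k * v ord0 k =
  q^-1 * (q * u ord0 k - v ord0 k) ^+ 2 / 2 by field; rewrite gt_eqF.
by rewrite divr_ge0 // mulr_ge0 ?sqr_ge0 // invr_ge0 ltW.
Qed.

(** Young's inequality with weight [q / K], which turns the [K ^+ 2] of the squared Lipschitz bound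
    into [K]. For [K = 0] this weight makes no sense, but then [u = 0]. *)
Lemma dotp_lipschitz K q u v y : 0 <= K -> 0 < q -> enorm u <= K * enorm y ->
  dotp u v <= K / 2 * (q * sqnorm y + q^-1 * sqnorm v).
Proof.
move=> K0 q0 uy; move: K0; rewrite le_eqVlt => /predU1P[K0|K0].
  have u0 k : u ord0 k = 0.
    have : sqnorm u <= 0 by move: uy; rewrite -K0 mul0r -enorm_sqr => uy;
      rewrite exprn_even_le0 //=; apply/eqP/le_anti; rewrite uy enorm_ge0.
    rewrite le_eqVlt ltNge sqnorm_ge0 orbF psumr_eq0 => [|i _]; last exact: sqr_ge0.
    by move=> /allP /(_ k (mem_index_enum _)) /=; rewrite sqrf_eq0 => /eqP.
  by rewrite -K0 mul0r mul0r /dotp big1 // => k _; rewrite u0 mul0r.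
have p0 : 0 < q / K by rewrite divr_gt0.
apply: le_trans (dotp_young u v p0) _.
have us : sqnorm u <= K ^+ 2 * sqnorm y.
  rewrite -!enorm_sqr -exprMn ler_sqr ?nnegrE ?enorm_ge0 //.
  by rewrite mulr_ge0 ?enorm_ge0 // ltW.
have -> : K / 2 * (q * sqnorm y + q^-1 * sqnorm v) =
  (q / K * (K ^+ 2 * sqnorm y) + (q / K)^-1 * sqnorm v) / 2.
  by field; rewrite !gt_eqF.
rewrite ler_pM2r; last by rewrite invr_gt0.
by rewrite lerD2r ler_wpM2l // ltW.
Qed.

Variables (f : 'rV[R]_n -> R^o) (L : R).
Hypothesis f_diff : forall y, differentiable f y.
Hypothesis f_smooth : forall y z : 'rV[R]_n,
  enorm (gradient f y - gradient f z) <= L * enorm (y - z).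

Lemma lipschitz_ge0 : (0 < n)%N -> 0 <= L.
Proof.
move=> n0; have := f_smooth (const_mx 1) 0.
have s1 : 0 < enorm (const_mx 1 - 0 : 'rV[R]_n).
  rewrite sqrtr_gt0 subr0; under eq_bigr do rewrite mxE expr1n.
  by rewrite sumr_const card_ord ltr0n.
by move=> /(le_trans (enorm_ge0 _)); rewrite pmulr_lge0.
Qed.

Lemma derive_gradient y v : 'D_v f y = dotp (gradient f y) v.
Proof.
rewrite deriveE // {1}(row_sum_delta v) linear_sum; apply: eq_bigr => k _.
by rewrite linearZ /= mxE deriveE // mulrC.
Qed.

(** Along the line, the difference quotient is the very one that defines the directional derivative
    at [y + s *: v]. *)
Lemma is_derive_line y v (s : R) :
  is_derive s (1 : R) (fun r : R => f (y + r *: v) : R^o) (dotp (gradient f (y + s *: v)) v).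
Proof.
have E : (fun h : R => h^-1 *: (((fun r : R => f (y + r *: v) : R^o) \o shift s)
             (h *: (1 : R^o)) - f (y + s *: v)))
       = (fun h : R => h^-1 *: ((f \o shift (y + s *: v)) (h *: v) - f (y + s *: v))).
  apply/funext => h /=; congr (_ *: (f _ - _)).
  by rewrite [h%:A]mulr1 scalerDl addrCA.
apply: DeriveDef; rewrite /derivable /derive E.
  exact: diff_derivable.
exact: derive_gradient.
Qed.

(** The mean value theorem for [psi], which compares [f] along the segment with its quadratic model.
    Its derivative is nonpositive between 0 and 1, because the gradient moves by at most [L * s]
    times the length of [v]. *)
Lemma smooth_descent y v : (0 < n)%N ->
  f (y + v) <= f y + dotp (gradient f y) v + L / 2 * sqnorm v.
Proof.
move=> n0; have L0 := lipschitz_ge0 n0.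
pose A := dotp (gradient f y) v; pose B := L / 2 * sqnorm v.
pose psi (s : R) : R := f (y + s *: v) - (s * A + s ^+ 2 * B).
pose dpsi (s : R) : R := dotp (gradient f (y + s *: v)) v - (A + s * B *+ 2).
have Dpsi (s : R) : is_derive s (1 : R) psi (dpsi s).
  apply: is_deriveB; first exact: is_derive_line.
  apply: is_deriveD.
    by apply: is_derive_eq; rewrite /GRing.scale /=; ring.
  by apply: is_derive_eq; rewrite /GRing.scale /=; ring.
have cpsi : {within `[0, 1], continuous psi}.
  apply: derivable_within_continuous => s _.
  exact: (@ex_derive _ _ _ _ _ _ _ (Dpsi s)).
have [s] := MVT ltr01 (fun s _ => Dpsi s) cpsi.
rewrite in_itv /= => /andP[s0 s1]; rewrite subr0 mulr1 => psiE.
have : dpsi s <= 0.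
  have : dotp (gradient f (y + s *: v) - gradient f y) v <=
         (L * s) / 2 * (1 * sqnorm v + 1^-1 * sqnorm v).
    apply: dotp_lipschitz => //; first by rewrite mulr_ge0 // ltW.
    apply: le_trans (f_smooth _ _) _.
    by rewrite addrAC subrr add0r enormZ ?(ltW s0) // mulrA.
  rewrite dotpDl dotpNl -/A invr1 !mul1r /dpsi /B mulr2n => h.
  rewrite subr_le0 -lerBlDl (le_trans h) // le_eqVlt; apply/orP; left.
  by apply/eqP; field.
rewrite -psiE /psi scale1r scale0r addr0 mul0r expr0n /= mul0r mul1r expr1n mul1r.
by rewrite addr0 subr0 /A /B => h; lra.
Qed.

Variables (mu lambda : R) (T : nat) (m x D : nat -> 'rV[R]_n).
Hypotheses (mu_ge0 : 0 <= mu) (mu_lt1 : mu < 1) (lambda_ge0 : 0 <= lambda)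
  (lambda_le : lambda <= 1 / (1 - mu)).
Hypothesis m0 : m 0 = 0.
Hypothesis mS : forall t, (1 <= t <= T)%N -> m t = mu *: m t.-1 - D t.
Hypothesis xS : forall t, (1 <= t <= T)%N ->
  x t.+1 = x t + m t + (lambda * mu) *: (m t - m t.-1).

(* The shifted iterates [x t + shift *: m t.-1] move along [D t] only. *)
Let shift : R := mu * ((1 - mu)^-1 - lambda).

(** Convexity of the square: [mu *: u - v] is the convex combination of [u] and [- v / (1 - mu)]
    with weights [mu] and [1 - mu]. *)
Lemma sqnorm_momentum u v : sqnorm (mu *: u - v) <= mu * sqnorm u + (1 - mu)^-1 * sqnorm v.
Proof.
rewrite /sqnorm !mulr_sumr -big_split; apply: ler_sum => k _ /=.
rewrite !mxE -subr_ge0.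
have -> : mu * u ord0 k ^+ 2 + (1 - mu)^-1 * v ord0 k ^+ 2 - (mu * u ord0 k - v ord0 k) ^+ 2
  = mu / (1 - mu) * ((1 - mu) * u ord0 k + v ord0 k) ^+ 2.
  by field; rewrite gt_eqF // subr_gt0.
by rewrite mulr_ge0 ?sqr_ge0 // divr_ge0 // subr_ge0 ltW.
Qed.

Lemma momentum_descent l : (0 < n)%N -> (forall y, l <= f y) ->
  \sum_(1 <= t < T.+1) dotp (gradient f (x t)) (D t) <=
  (1 - mu) * (f (x 1%N) - l)
  + L * (1 + mu) / (2 * (1 - mu) ^+ 2) * \sum_(1 <= t < T.+1) sqnorm (D t).
Proof.
move=> n0 lf; have L0 := lipschitz_ge0 n0.
have mu1 : 0 < 1 - mu by rewrite subr_gt0.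
have mu1' : 1 - mu != 0 by rewrite gt_eqF.
(* The upper bound on [lambda] enters here. *)
have c0 : 0 <= shift by rewrite mulr_ge0 // subr_ge0 -div1r.
(* Lyapunov function: [f] at the shifted iterate plus a multiple of the squared
   momentum. *)
suff main t : (t <= T)%N ->
    (1 - mu) * (f (x t.+1 + shift *: m t) + L * shift / (2 * (1 - mu)) * sqnorm (m t))
    + \sum_(1 <= i < t.+1) dotp (gradient f (x i)) (D i) <=
    (1 - mu) * f (x 1%N)
    + L * (1 + 2 * shift) / (2 * (1 - mu)) * \sum_(1 <= i < t.+1) sqnorm (D i).
  have := main T (leqnn T).
  have S0 : 0 <= \sum_(1 <= t < T.+1) sqnorm (D t).
    by apply: sumr_ge0 => t _; exact: sqnorm_ge0.
  (* The factor [1 + 2 * shift] falls short of [(1 + mu) / (1 - mu)] by exactly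
     [2 * (mu * lambda)]. *)
  have : L * (1 + 2 * shift) / (2 * (1 - mu)) * \sum_(1 <= t < T.+1) sqnorm (D t) <=
         L * (1 + mu) / (2 * (1 - mu) ^+ 2) * \sum_(1 <= t < T.+1) sqnorm (D t).
    rewrite ler_wpM2r //.
    have -> : L * (1 + mu) / (2 * (1 - mu) ^+ 2) =
      L * ((1 + mu) / (1 - mu)) / (2 * (1 - mu)) by field.
    rewrite ler_wpM2r ?invr_ge0 ?mulr_ge0 ?(ltW mu1) // ler_wpM2l //.
    rewrite -subr_ge0.
    have -> : (1 + mu) / (1 - mu) - (1 + 2 * shift) = 2 * (mu * lambda).
      by rewrite /shift; field.
    by rewrite mulr_ge0 // mulr_ge0.
  have : 0 <= (1 - mu) * (f (x T.+1 + shift *: m T) - l).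
    by rewrite mulr_ge0 ?(ltW mu1) // subr_ge0.
  have : 0 <= (1 - mu) * (L * shift / (2 * (1 - mu)) * sqnorm (m T)).
    have K0 : 0 <= L * shift / (2 * (1 - mu)).
      by rewrite divr_ge0 ?(mulr_ge0 L0) // mulr_ge0 // ltW.
    by apply: mulr_ge0; [exact: ltW|exact: mulr_ge0 (sqnorm_ge0 _)].
  by move=> h1 h2 h3 h4; lra.
elim: t => [_|t ih tT].
  rewrite !big_geq // m0 scaler0 !addr0 mulr0 addr0.
  by rewrite /sqnorm big1 ?mulr0 ?addr0 // => k _; rewrite mxE expr0n.
have {ih} := ih (ltnW tT).
rewrite !(@big_nat_recr _ _ _ t.+1) //=.
set y := x t.+1 + shift *: m t; set d := D t.+1.
have mt : m t.+1 = mu *: m t - d by rewrite mS.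
(* [shift] is chosen so that the multiples of [m t] on the two sides cancel. *)
have zS : x t.+2 + shift *: m t.+1 = y + (- (1 - mu)^-1) *: d.
  rewrite xS // mt /y /shift; apply/rowP => k; rewrite !mxE.
  by field.
have := smooth_descent y (- (1 - mu)^-1 *: d) n0.
rewrite -zS dotpZr sqnormZ sqrrN.
have := sqnorm_momentum (m t) d; rewrite -mt.
have gE : dotp (gradient f y) d =
    dotp (gradient f (x t.+1)) d - dotp (gradient f (x t.+1) - gradient f y) d.
  by rewrite dotpDl dotpNl; ring.
have : dotp (gradient f (x t.+1) - gradient f y) d <=
    L * shift / 2 * ((1 - mu) * sqnorm (m t) + (1 - mu)^-1 * sqnorm d).
  apply: dotp_lipschitz => //; first exact: mulr_ge0.
  apply: le_trans (f_smooth _ _) _; rewrite -mulrA ler_wpM2l // -enormZ //.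
  rewrite /y opprD addrA subrr add0r /enorm le_eqVlt; apply/orP; left; apply/eqP.
  by congr Num.sqrt; apply: eq_bigr => k _; rewrite !mxE sqrrN.
rewrite gE => hY hm hf ih.
(* The terms in [sqnorm (m t)] balance: the momentum recursion contributes a share [mu] and the
   Lipschitz bound [hY] a share [1 - mu], together the weight [L * shift / 2] that the Lyapunov
   function provides. *)
have {}hm := ler_wpM2l (_ : 0 <= L * shift / 2) hm.
have {}hm : L * shift / 2 * sqnorm (m t.+1) <=
    L * shift / 2 * (mu * sqnorm (m t) + (1 - mu)^-1 * sqnorm d).
  by apply: hm; rewrite divr_ge0 // mulr_ge0.
have {}hf := ler_wpM2l (ltW mu1) hf.
have E1 : (1 - mu) * (f (x t.+2 + shift *: m t.+1)
      + L * shift / (2 * (1 - mu)) * sqnorm (m t.+1)) =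
    (1 - mu) * f (x t.+2 + shift *: m t.+1) + L * shift / 2 * sqnorm (m t.+1).
  by field.
have E2 : (1 - mu) * (f y + L * shift / (2 * (1 - mu)) * sqnorm (m t)) =
    (1 - mu) * f y + L * shift / 2 * sqnorm (m t) by field.
rewrite E2 in ih; rewrite E1.
set Dy := dotp _ d in hY hf; set Dx := dotp (gradient f (x t.+1)) d in hf *.
have E3 : (1 - mu) * (f y + - (1 - mu)^-1 * (Dx - Dy)
      + L / 2 * ((1 - mu)^-1 ^+ 2 * sqnorm d)) =
    (1 - mu) * f y - Dx + Dy + L / 2 * ((1 - mu)^-1 * sqnorm d) by field.
rewrite E3 in hf.
have E4 : L * (1 + 2 * shift) / (2 * (1 - mu)) =
  L / 2 * (1 - mu)^-1 + L * shift * (1 - mu)^-1 by field.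
rewrite E4 in ih *.
by lra.
Qed.
End smooth.

(** * Scalar inequalities *)

Section scalar.
Context {R : realType}.
Implicit Types (a b g h s e : R).

(** The point of tangency [c] is free: one choice makes sums telescope, another makes the bound
    affine in the random quantities. *)
Lemma ln_le_tangent (y c : R) : 0 < y -> 0 < c -> ln y <= ln c + (y / c - 1).
Proof.
move=> y0 c0; rewrite -lerBlDl -ln_div ?posrE //.
have yc : 0 < y / c by rewrite divr_gt0.
have := @le_ln1Dx R (y / c - 1).
rewrite (_ : 1 + (y / c - 1) = y / c); last by ring.
by apply; lra.
Qed.

(** The tangent at the new partial sum bounds each term by an increment of the logarithm, and the
    increments telescope. *)
Lemma sum_ratio_le_ln (b : nat -> R) e T : 0 < e -> (forall t, 0 <= b t) ->
  \sum_(1 <= t < T.+1) b t / (\sum_(1 <= i < t.+1) b i + e) <=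
  ln (1 + (\sum_(1 <= t < T.+1) b t) / e).
Proof.
move=> e0 b0; elim: T => [|T ih].
  by rewrite !big_geq // mul0r addr0 ln1.
rewrite !(@big_nat_recr _ _ _ T.+1) //=.
set V := \sum_(1 <= i < T.+1) b i in ih *.
have V0 : 0 <= V by apply: sumr_ge0 => i _.
have bT := b0 T.+1; set bb := b T.+1 in bT *.
apply: le_trans (lerD ih (lexx _)) _.
have h1 : 0 < 1 + (V + bb) / e.
  by rewrite ltr_pwDl // divr_ge0 ?addr_ge0 // ltW.
have h2 : 0 < 1 + V / e by rewrite ltr_pwDl // divr_ge0 // ltW.
have := ln_le_tangent h2 h1.
have -> : (1 + V / e) / (1 + (V + bb) / e) - 1 = - (bb / (V + bb + e)).
  have h3 : 0 < V + bb + e by lra.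
  field; rewrite !gt_eqF //.
by lra.
Qed.

(** For a nonrandom [C] the right-hand side is affine in [b], so its expectation is explicit; this
    stands in for Jensen's inequality. *)
Lemma sum_ratio_le (b : nat -> R) e C T : 0 < e -> 0 < C -> (forall t, 0 <= b t) ->
  \sum_(1 <= t < T.+1) b t / (\sum_(1 <= i < t.+1) b i + e) <=
  ln C + ((1 + (\sum_(1 <= t < T.+1) b t) / e) / C - 1).
Proof.
move=> e0 C0 b0; apply: le_trans (sum_ratio_le_ln T e0 b0) (ln_le_tangent _ C0).
by rewrite ltr_pwDl // divr_ge0 ?sumr_ge0 // ltW.
Qed.

(** * Comparing the step size with its surrogate *)

Section one_step.
Variables (W a ab s eps g : R).
Hypotheses (W0 : 0 <= W) (ab1 : 1 <= ab) (aba : ab <= a) (s0 : 0 < s) (eps0 : 0 < eps).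

(** [W] stands for the weighted sum of the past squares. [p] is the actual denominator of the step,
    [q] the surrogate one, and [r] a term of the sum that telescopes into a logarithm. *)
Let v := (W + a * g ^+ 2) / ab.
Let vs := (W + a * s ^+ 2) / ab.
Let p := Num.sqrt v + eps.
Let q := Num.sqrt vs + eps.
Let r := a * g ^+ 2 / (W + a * g ^+ 2 + eps ^+ 2).

Let ab0 : 0 < ab. Proof. exact: lt_le_trans ab1. Qed.
Let a0 : 0 < a. Proof. exact: lt_le_trans aba. Qed.
Let p0 : 0 < p. Proof. by rewrite ltr_wpDl ?sqrtr_ge0. Qed.
Let q0 : 0 < q. Proof. by rewrite ltr_wpDl ?sqrtr_ge0. Qed.
Let ag0 : 0 <= a * g ^+ 2. Proof. by rewrite mulr_ge0 ?sqr_ge0 // ltW. Qed.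
Let as0 : 0 <= a * s ^+ 2. Proof. by rewrite mulr_ge0 ?sqr_ge0 // ltW. Qed.
Let v0 : 0 <= v. Proof. by rewrite divr_ge0 ?addr_ge0 // ltW. Qed.
Let vs0 : 0 <= vs. Proof. by rewrite divr_ge0 ?addr_ge0 // ltW. Qed.
Let e2 : 0 < eps ^+ 2. Proof. exact: exprn_gt0. Qed.

(** Expanding the square gives [v + eps ^+ 2 <= p ^+ 2]. After clearing [ab], the condition
    [1 <= ab] lowers [ab * eps ^+ 2] to [eps ^+ 2], which leaves the denominator of [r]. *)
Lemma weighted_ratio_le : a / ab * (g ^+ 2 / p ^+ 2) <= r.
Proof.
have pv : v + eps ^+ 2 <= p ^+ 2.
  rewrite /p sqrrD sqr_sqrtr // -addrA lerD2l lerDr mulrn_wge0 //.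
  by rewrite mulr_ge0 ?sqrtr_ge0 // ltW.
have ve : 0 < v + eps ^+ 2 by rewrite ltr_wpDl.
apply: (@le_trans _ _ (a / ab * (g ^+ 2 / (v + eps ^+ 2)))).
  rewrite ler_wpM2l ?divr_ge0 ?(ltW a0) ?(ltW ab0) // ler_wpM2l ?sqr_ge0 //.
  by rewrite lef_pV2 ?posrE // exprn_gt0.
have h : 0 < W + a * g ^+ 2 + eps ^+ 2 by rewrite ltr_wpDl // addr_ge0.
have h' : W + a * g ^+ 2 + eps ^+ 2 <= W + a * g ^+ 2 + ab * eps ^+ 2.
  by rewrite lerD2l ler_peMl // ltW.
have -> : a / ab * (g ^+ 2 / (v + eps ^+ 2)) = a * g ^+ 2 / (W + a * g ^+ 2 + ab * eps ^+ 2).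
  rewrite /v; field; rewrite !gt_eqF //=; first exact: lt_le_trans h'.
rewrite /r ler_wpM2l // lef_pV2 ?posrE //; exact: lt_le_trans h'.
Qed.

Lemma step_sqr_le : (g / p) ^+ 2 <= r.
Proof.
apply: le_trans weighted_ratio_le; rewrite expr_div_n ler_peMl //.
  by rewrite divr_ge0 ?sqr_ge0.
by rewrite ler_pdivlMr // mul1r.
Qed.

(** The cost of replacing [p] by [q] is split by AM-GM. One part becomes a multiple of [s * r]; the
    other is at most half of [h ^+ 2 / q] once [g ^+ 2] is averaged to at most [s ^+ 2], thanks to
    the factor [4]. *)
Lemma step_decorrelate h :
  h * g / q - h ^+ 2 * (s ^+ 2 + g ^+ 2) / (4 * s ^+ 2) / q - s * r <= h * g / p.
Proof.
pose A := Num.sqrt (a / ab).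
have aab : 1 <= a / ab by rewrite ler_pdivlMr // mul1r.
have A2 : A ^+ 2 = a / ab by rewrite sqr_sqrtr // ltW // (lt_le_trans _ aab).
have A1 : 1 <= A by rewrite -[leLHS]sqrtr1 ler_wsqrtr.
have A0 : 0 < A by apply: lt_le_trans A1.
have Ev : v = W / ab + A ^+ 2 * g ^+ 2 by rewrite A2 /v; field; rewrite gt_eqF.
have Evs : vs = W / ab + A ^+ 2 * s ^+ 2 by rewrite A2 /vs; field; rewrite gt_eqF.
have Wab : 0 <= W / ab by rewrite divr_ge0 // ltW.
have hv : A * `|g| <= Num.sqrt v.
  rewrite -(@ger0_norm _ (A * `|g|)) ?mulr_ge0 ?(ltW A0) ?(ltW s0) // -sqrtr_sqr.
  by rewrite ler_wsqrtr // exprMn real_normK ?num_real // Ev lerDr.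
have hvs : A * s <= Num.sqrt vs.
  rewrite -(@ger0_norm _ (A * s)) ?mulr_ge0 ?(ltW A0) ?(ltW s0) // -sqrtr_sqr.
  by rewrite ler_wsqrtr // exprMn Evs lerDr.
(* The square roots are at least [A * s] and [A] times the absolute value of [g], while their
   squares differ by [A ^+ 2 * (s ^+ 2 - g ^+ 2)]. The common factor is divided out. *)
have dif : `|Num.sqrt vs - Num.sqrt v| <= A * `|s - `|g| |.
  have sg : 0 < A * (s + `|g|) by rewrite mulr_gt0 // ltr_pwDl.
  rewrite -(ler_pM2r sg).
  apply: (@le_trans _ _ (`|Num.sqrt vs - Num.sqrt v| * (Num.sqrt vs + Num.sqrt v))).
    by rewrite ler_wpM2l // mulrDr lerD.
  have hs : 0 <= Num.sqrt vs + Num.sqrt v by rewrite addr_ge0 ?sqrtr_ge0.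
  rewrite -{1}(ger0_norm hs) -normrM -subr_sqr !sqr_sqrtr // Ev Evs.
  have -> : W / ab + A ^+ 2 * s ^+ 2 - (W / ab + A ^+ 2 * g ^+ 2) =
    A ^+ 2 * ((s - `|g|) * (s + `|g|)).
    by rewrite -subr_sqr real_normK ?num_real //; ring.
  have sg' : 0 <= s + `|g| by rewrite addr_ge0 // ltW.
  rewrite normrM (ger0_norm (sqr_ge0 A)) normrM (ger0_norm sg').
  by rewrite le_eqVlt; apply/orP; left; apply/eqP; ring.
have hpq : h * g / q - h * g / p = h * g * ((p - q) / (p * q)).
  by field; rewrite !gt_eqF.
have hpq' : p - q = - (Num.sqrt vs - Num.sqrt v) by rewrite /p /q; ring.
have main1 : h * g / q - h * g / p <= `|h| * `|s - `|g| | * (A * `|g| / p) / q.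
  rewrite hpq; apply: le_trans (ler_norm _) _.
  rewrite normrM normrM normrM hpq' normrN normfV (ger0_norm (ltW (mulr_gt0 p0 q0))).
  have -> : `|h| * `|s - `|g| | * (A * `|g| / p) / q =
    `|h| * `|g| * (A * `|s - `|g| | / (p * q)) by field; rewrite !gt_eqF.
  by rewrite ler_wpM2l // ler_wpM2r // invr_ge0 ltW // mulr_gt0.
(* AM-GM: [x y <= x ^ 2 / (4 s ^ 2) + s ^ 2 y ^ 2] *)
have amgm (x y : R) : x * y <= x ^+ 2 / (4 * s ^+ 2) + s ^+ 2 * y ^+ 2.
  rewrite -subr_ge0.
  have -> : x ^+ 2 / (4 * s ^+ 2) + s ^+ 2 * y ^+ 2 - x * y =
    (x / (2 * s) - s * y) ^+ 2 by field; rewrite gt_eqF.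
  exact: sqr_ge0.
have main2 : `|h| * `|s - `|g| | * (A * `|g| / p) / q <=
    h ^+ 2 * (s ^+ 2 + g ^+ 2) / (4 * s ^+ 2) / q + s ^+ 2 * (A * `|g| / p) ^+ 2 / q.
  rewrite -mulrDl ler_pM2r ?invr_gt0 //; apply: le_trans (amgm _ _) _.
  rewrite lerD2r; apply: ler_wpM2r; first by rewrite invr_ge0 mulr_ge0 // sqr_ge0.
  rewrite exprMn !real_normK ?num_real // ler_wpM2l ?sqr_ge0 // sqrrB.
  rewrite real_normK ?num_real // addrAC lerBlDr lerDl.
  by rewrite mulrn_wge0 // mulr_ge0 // ltW.
have main3 : s ^+ 2 * (A * `|g| / p) ^+ 2 / q <= s * r.
  (* This lower bound on [q] absorbs one factor [s] and one factor [A]. *)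
  have qA : A * s <= q by rewrite (le_trans hvs) // lerDl ltW.
  apply: (@le_trans _ _ (s ^+ 2 * (A * `|g| / p) ^+ 2 / (A * s))).
    apply: ler_wpM2l; first by apply: mulr_ge0; exact: sqr_ge0.
    by rewrite lef_pV2 ?posrE // mulr_gt0.
  have -> : s ^+ 2 * (A * `|g| / p) ^+ 2 / (A * s) = s * (A * (g ^+ 2 / p ^+ 2)).
    rewrite -[g ^+ 2]real_normK ?num_real //.
    by field; rewrite !gt_eqF.
  rewrite ler_wpM2l ?(ltW s0) //; apply: le_trans weighted_ratio_le.
  apply: ler_wpM2r; first by apply: divr_ge0; exact: sqr_ge0.
  by rewrite -A2 expr2 ler_peMl // ltW.
by lra.
Qed.

End one_step.

(** Young's inequality for the product of two factors: the power 2/3 of [c * w] times the power 4/3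
    of [H], and the power -2/3 of [c * w]. *)
Lemma powR43_young (H w c : R) : 0 <= H -> 0 < w -> 0 < c ->
  H `^ (4 / 3) <= 2 / 3 * (c * (H ^+ 2 * w)) + 3^-1 * (w ^- 2 / c ^+ 2).
Proof.
move=> H0 w0 c0; have cw : 0 < c * w by rewrite mulr_gt0.
have := @conjugate_powR R ((c * w) `^ (2 / 3) * H `^ (4 / 3)) ((c * w) `^ (- (2 / 3))) (3 / 2) 3.
rewrite mulr_ge0 ?powR_ge0 // => /(_ isT isT).
have E : (c * w) `^ (2 / 3) * (c * w) `^ (- (2 / 3)) = 1.
  by rewrite -powRD ?subrr ?powRr0 // (gt_eqF cw) implybT.
rewrite mulrAC E mul1r.
rewrite powRM ?powR_ge0 // -!powRrM.
have -> : 2 / 3 * (3 / 2) = 1 :> R by field.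
have -> : 4 / 3 * (3 / 2) = 2 :> R by field.
have -> : - (2 / 3) * 3 = - 2 :> R by field.
rewrite powRr1 ?(ltW cw) // powRN !powR_mulrn ?(ltW cw) //.
move=> h; apply: le_trans (h _ _ _) _; [lra|lra|by field|].
rewrite le_eqVlt; apply/orP; left; apply/eqP.
by field; rewrite !gt_eqF.
Qed.

(** Choosing [c] from [y] rather than from [B] avoids a cube root and a division by [B]; only
    [y = 0] needs a separate case. *)
Lemma powR32_optimize (y B Q : R) : 0 <= y -> 0 <= B -> 0 < Q ->
  (forall c, 0 < c -> y <= 2 / 3 * (c * B) + 3^-1 * (Q / c ^+ 2)) ->
  y `^ (3 / 2) <= Num.sqrt Q * B.
Proof.
move=> y0 B0 Q0 h; pose r := Num.sqrt y.
have yr : y = r ^+ 2 by rewrite sqr_sqrtr.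
have -> : y `^ (3 / 2) = r ^+ 3.
  rewrite yr -powR_mulrn ?sqrtr_ge0 // -powRrM -powR_mulrn ?sqrtr_ge0 //.
  by congr (_ `^ _); field.
have q0 : 0 < Num.sqrt Q by rewrite sqrtr_gt0.
have := sqrtr_ge0 y; rewrite -/r le_eqVlt => /predU1P[<-|r0].
  by rewrite expr0n mulr_ge0 // ltW.
(* At the optimal [c] the last term of the bound equals [y / 3]. *)
have := h (Num.sqrt Q / r) (divr_gt0 q0 r0).
have -> : Q / (Num.sqrt Q / r) ^+ 2 = r ^+ 2.
  rewrite -{1}(sqr_sqrtr (ltW Q0)); field; rewrite !gt_eqF //.
have -> : Num.sqrt Q / r * B = Num.sqrt Q * B / r by rewrite mulrAC.
rewrite yr => h1; have : r ^+ 2 <= Num.sqrt Q * B / r by lra.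
by rewrite ler_pdivlMr // -exprSr.
Qed.

End scalar.

(** * Constants of the bound *)

Section constants.
Context {R : realType}.
Variables (eta eps mu lambda sigma : R) (a : nat -> R).
Hypotheses (eta_gt0 : 0 < eta) (eps_gt0 : 0 < eps) (mu_ge0 : 0 <= mu) (mu_lt1 : mu < 1).
Hypotheses (lambda_ge0 : 0 <= lambda) (lambda_le : lambda <= 1 / (1 - mu)).
Hypothesis sigma_ge0 : 0 <= sigma.

(** Amounts to [(1 - mu) * (1 + lambda * mu) <= 1], whose gap is [mu * (1 - lambda * (1 - mu))]; the
    upper bound on [lambda] makes it nonnegative. *)
Lemma adausm_C1_ge (Delta : R) : 0 <= Delta ->
  2 * (1 - mu) * Delta / eta <= adausm_C1 Delta eta mu lambda.
Proof.
move=> D0; have mu1 : 0 < 1 - mu by rewrite subr_gt0.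
have lm : 0 < 1 + lambda * mu by rewrite ltr_pwDl // mulr_ge0.
rewrite /adausm_C1 -subr_ge0.
have -> : 2 * Delta / ((1 + lambda * mu) * eta) - 2 * (1 - mu) * Delta / eta =
  2 * Delta / eta * ((1 - (1 - mu) * (1 + lambda * mu)) / (1 + lambda * mu)).
  by field; rewrite !gt_eqF.
have h : lambda * (1 - mu) <= 1 by rewrite -ler_pdivlMr.
apply: mulr_ge0; first by rewrite divr_ge0 ?mulr_ge0 // ltW.
rewrite divr_ge0 ?(ltW lm) //.
have -> : 1 - (1 - mu) * (1 + lambda * mu) = mu * (1 - lambda * (1 - mu)) by ring.
by rewrite mulr_ge0 // subr_ge0.
Qed.

(** The two summands are compared separately. The one with [L] reduces to [(1 + mu) * (1 - mu) * (1
    + lambda * mu) <= 1 + lambda], which is far below [2 * (1 + 2 * lambda) ^+ 2]. *)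
Lemma adausm_C2_ge (L : R) n : 0 <= L ->
  2 * (L * (1 + mu) / (2 * (1 - mu) ^+ 2) * eta + sigma) * n%:R <=
  adausm_C2 eta mu lambda sigma L n.
Proof.
move=> L0; have mu1 : 0 < 1 - mu by rewrite subr_gt0.
have lm : 0 < 1 + lambda * mu by rewrite ltr_pwDl // mulr_ge0.
have n0 : 0 <= n%:R :> R by [].
rewrite /adausm_C2.
have h1 : 2 * sigma * n%:R <= 4 * sigma * n%:R / (1 - mu).
  rewrite ler_pdivlMr // -subr_ge0.
  have -> : 4 * sigma * n%:R - 2 * sigma * n%:R * (1 - mu) = 2 * sigma * n%:R * (1 + mu) by ring.
  by rewrite !mulr_ge0 // addr_ge0.
have h2 : L * (1 + mu) / (1 - mu) ^+ 2 * eta * n%:R <=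
    2 * eta * (1 + 2 * lambda) ^+ 2 * L * n%:R / ((1 + lambda * mu) * (1 - mu) ^+ 3).
  rewrite -subr_ge0.
  have -> : 2 * eta * (1 + 2 * lambda) ^+ 2 * L * n%:R / ((1 + lambda * mu) * (1 - mu) ^+ 3)
     - L * (1 + mu) / (1 - mu) ^+ 2 * eta * n%:R =
     eta * L * n%:R * ((2 * (1 + 2 * lambda) ^+ 2 - (1 + mu) * (1 - mu) * (1 + lambda * mu))
       / ((1 + lambda * mu) * (1 - mu) ^+ 3)).
    by field; rewrite !gt_eqF.
  apply: mulr_ge0; first by rewrite !mulr_ge0 // ltW.
  apply: divr_ge0; last by rewrite mulr_ge0 ?exprn_ge0 // ltW.
  have h3 : lambda * mu <= lambda by rewrite ler_piMr // ltW.
  have h4 : (1 + mu) * (1 - mu) * (1 + lambda * mu) <= 1 * (1 + lambda).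
    apply: ler_pM => //; [|exact: ltW| |].
    - by rewrite mulr_ge0 ?(ltW mu1) // addr_ge0.
    - have -> : (1 + mu) * (1 - mu) = 1 - mu ^+ 2 by ring.
      by rewrite gerBl sqr_ge0.
    - by rewrite lerD2l.
  have -> : (1 + 2 * lambda) ^+ 2 = 1 + 4 * lambda + 4 * lambda ^+ 2 by ring.
  have h5 : 0 <= lambda ^+ 2 by exact: sqr_ge0.
  move: h4 h5 lambda_ge0; set X := (1 + mu) * _ * _; set Y := lambda ^+ 2.
  by rewrite mul1r => ? ? ?; lra.
have -> : 2 * (L * (1 + mu) / (2 * (1 - mu) ^+ 2) * eta + sigma) * n%:R =
  L * (1 + mu) / (1 - mu) ^+ 2 * eta * n%:R + 2 * sigma * n%:R.
  by field; rewrite gt_eqF.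
exact: lerD.
Qed.

Hypothesis a_norm : 1 <= a 1%N.
Hypothesis a_nondec : forall s t, (1 <= s)%N -> (s <= t)%N -> a s <= a t.

Lemma weight_ge1 t : (1 <= t)%N -> 1 <= a t.
Proof. by move=> t1; apply: le_trans a_norm (a_nondec _ t1). Qed.

Lemma abar_ge1 t : (1 <= t)%N -> 1 <= abar a t.
Proof.
move=> t1; rewrite ler_pdivlMr ?ltr0n // mul1r.
have -> : t%:R = \sum_(1 <= i < t.+1) (1 : R) by rewrite sumr_const_nat subSS subn0.
by rewrite !big_nat; apply: ler_sum => i /andP[i1 _]; exact: weight_ge1.
Qed.

Lemma abar_le t : (1 <= t)%N -> abar a t <= a t.
Proof.
move=> t1; rewrite ler_pdivrMr ?ltr0n //.
have -> : a t * t%:R = \sum_(1 <= i < t.+1) a t.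
  by rewrite sumr_const_nat subSS subn0 mulr_natr.
by rewrite !big_nat; apply: ler_sum => i /andP[i1 it]; exact: a_nondec.
Qed.

Lemma sum_weight_ge T : T%:R <= \sum_(1 <= t < T.+1) a t.
Proof.
have -> : T%:R = \sum_(1 <= t < T.+1) (1 : R) by rewrite sumr_const_nat subSS subn0.
by rewrite !big_nat; apply: ler_sum => i /andP[i1 _]; exact: weight_ge1.
Qed.

(** From [T' = 2] on, the weights sum to at least 2, so constants are absorbed into the logarithm of
    the sum at the price of [1 / ln 2]. As [adausm_C2] is linear in the dimension, [c2] is its value
    in dimension 1 and one constant serves all dimensions. *)
Lemma adausm_bound_bigO (Delta L : R) : exists K : R, \forall T' \near \oo,
  forall n', (0 < n')%N ->
    `|adausm_bound Delta eta eps mu lambda sigma L a n' T'| <=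
       K * `|n'%:R * ln (\sum_(1 <= t < T'.+1) a t) / Num.sqrt T'%:R|.
Proof.
pose rho := sigma ^+ 2 / eps ^+ 2.
pose c1 : R := `|adausm_C1 Delta eta mu lambda|.
pose c2 : R := `|adausm_C2 eta mu lambda sigma L 1|.
pose kap := ln (1 + rho) / ln 2 + 1.
pose q0 : R := Num.sqrt (2 * eps ^+ 2 + 2 * sigma ^+ 2).
have c10 : 0 <= c1 by exact: normr_ge0.
have c20 : 0 <= c2 by exact: normr_ge0.
have rho0 : 0 <= rho by rewrite divr_ge0 ?sqr_ge0.
have ln20 : 0 < ln 2 :> R by rewrite ln_gt0 // ltr1n.
exists (q0 * (c1 / ln 2 + c2 * kap)); exists 2%N => // T' /= T2 n' n0.
have T0 : 0 < T'%:R :> R by rewrite ltr0n (leq_trans _ T2).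
set S := \sum_(1 <= t < T'.+1) a t.
have S2 : 2 <= S by apply: le_trans (sum_weight_ge T'); rewrite ler_nat.
have S0 : 0 < S by apply: lt_le_trans S2.
have lnS : ln 2 <= ln S by rewrite ler_ln ?posrE.
have lnS0 : 0 < ln S by apply: lt_le_trans lnS.
have lnr0 : 0 <= ln (1 + rho) by rewrite ln_ge0 // lerDl.
have lnrS : `|ln (1 + rho * S)| <= kap * ln S.
  have rS : 0 <= rho * S by rewrite mulr_ge0 // ltW.
  rewrite ger0_norm; last by rewrite ln_ge0 // lerDl.
  (* Since [1 <= S], the argument is at most [(1 + rho) * S], whose logarithm splits into a sum. *)
  apply: (@le_trans _ _ (ln ((1 + rho) * S))).
    rewrite ler_ln ?posrE ?mulr_gt0 // ?ltr_pwDl // mulrDl mul1r lerD2r.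
    by apply: le_trans S2; rewrite ler1n.
  rewrite lnM ?posrE ?ltr_pwDl // /kap mulrDl mul1r lerD2r.
  by rewrite mulrAC ler_pdivlMr // ler_wpM2l.
have n1 : 1 <= n'%:R :> R by rewrite ler1n.
have C2n : adausm_C2 eta mu lambda sigma L n' = n'%:R * adausm_C2 eta mu lambda sigma L 1.
  by rewrite /adausm_C2; ring.
have inner : `|adausm_C1 Delta eta mu lambda
     + adausm_C2 eta mu lambda sigma L n' * ln (1 + rho * S)| <=
   (c1 / ln 2 + c2 * kap) * (n'%:R * ln S).
  rewrite [leRHS]mulrDl; apply: (le_trans (ler_normD _ _)).
  apply: (@lerD R).
    rewrite -/c1 mulrAC ler_pdivlMr // ler_wpM2l //.
    by apply: (le_trans lnS); rewrite ler_peMl // ltW.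
  rewrite C2n !normrM -/c2 ger0_norm //.
  have -> : c2 * kap * (n'%:R * ln S) = n'%:R * c2 * (kap * ln S) by ring.
  by rewrite ler_wpM2l // mulr_ge0.
have outer : Num.sqrt (2 * eps ^+ 2 + 2 * sigma ^+ 2 * T'%:R) / T'%:R <=
    q0 / Num.sqrt T'%:R.
  have sT : 0 < Num.sqrt T'%:R :> R by rewrite sqrtr_gt0.
  have e0 : 0 <= 2 * eps ^+ 2 by rewrite mulr_ge0 ?sqr_ge0.
  have s0 : 0 <= 2 * sigma ^+ 2 by rewrite mulr_ge0 ?sqr_ge0.
  rewrite ler_pdivrMr //.
  have -> : q0 / Num.sqrt T'%:R * T'%:R = q0 * Num.sqrt T'%:R.
    by rewrite -[X in _ * X = _](sqr_sqrtr (ltW T0)); field; rewrite gt_eqF.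
  have T1 : 1 <= T'%:R :> R by rewrite ler1n ltnW.
  have h : 2 * eps ^+ 2 <= 2 * eps ^+ 2 * T'%:R by rewrite ler_peMr.
  by rewrite /q0 -sqrtrM ?addr_ge0 // ler_wsqrtr // [leRHS]mulrDl lerD.
rewrite /adausm_bound -/rho -/S normrM.
rewrite (ger0_norm (_ : 0 <= _ / _)); last by rewrite divr_ge0 ?sqrtr_ge0.
apply: le_trans (ler_pM _ _ outer inner) _ => //.
rewrite ger0_norm; last by rewrite divr_ge0 ?sqrtr_ge0 // mulr_ge0 // ltW.
by rewrite le_eqVlt; apply/orP; left; apply/eqP; ring.
Qed.

End constants.

(** * Measurability of coordinates, norms and step sizes *)

Section measurability.
Context {R : realType}.

Lemma measurable_inv_sqrtD (eps : R) : 0 < eps ->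
  measurable_fun setT (fun y : R => (Num.sqrt y + eps)^-1).
Proof.
move=> e0; apply: continuous_measurable_fun => y.
apply: cvgV; first by rewrite gt_eqF // ltr_wpDl ?sqrtr_ge0.
by apply: cvgD; [exact: sqrt_continuous|exact: cvg_cst].
Qed.

Lemma measurable_sqrtr : measurable_fun setT (@Num.sqrt R).
Proof. by apply: continuous_measurable_fun; exact: sqrt_continuous. Qed.

Lemma measurable_coord n (k : 'I_n) : measurable_fun setT (fun v : 'rV[R]_n => v ord0 k).
Proof.
move=> _ B mB; rewrite setTI; apply: sub_gen_smallest.
rewrite -bigcup_seq; exists k => /=; first exact: mem_index_enum.
by exists B => //; rewrite setTI.
Qed.

(** The coordinates generate the sigma-algebra on row vectors, so only their preimages have to be
    checked. *)
Lemma measurable_rV d (S : measurableType d) n (X : S -> 'rV[R]_n) :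
  (forall k, measurable_fun setT (fun w => X w ord0 k)) -> measurable_fun setT X.
Proof.
move=> mX; apply: (measurability (\big[setU/set0]_(i < n)
  preimage_set_system setT (fun v : 'rV[R]_n => v ord0 i) measurable)) => //.
move=> _ [A + <-]; rewrite -bigcup_seq => -[k _ [B mB <-]].
by rewrite !setTI; have := mX k measurableT B mB; rewrite setTI.
Qed.

Lemma measurable_sum_nat d (S : measurableType d) (i j : nat) (X : nat -> S -> R) :
  (forall k, (i <= k < j)%N -> measurable_fun setT (X k)) ->
  measurable_fun setT (fun w => \sum_(i <= k < j) X k w).
Proof.
move=> mX; under eq_fun do rewrite big_nat big_mkcond.
by apply: measurable_sum => k; case: (boolP (_ <= k < _)%N) => [/mX|_].
Qed.

Lemma measurable_enorm d (S : measurableType d) n (X : S -> 'rV[R]_n) :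
  (forall k, measurable_fun setT (fun w => X w ord0 k)) ->
  measurable_fun setT (fun w => enorm (X w)).
Proof.
move=> mX; apply: (measurableT_comp measurable_sqrtr).
by apply: measurable_sum => k; exact: measurable_funX.
Qed.

End measurability.

(** * The bound for adapted gradients *)

Section core.
Context {d : measure_display} {Omega : measurableType d} {R : realType}.
Variable P : probability Omega R.
Variables (n T : nat) (g h : nat -> Omega -> 'rV[R]_n) (C : nat -> set_system Omega).
Variables (a : nat -> R) (eps s : R).
Hypotheses (eps_gt0 : 0 < eps) (s_gt0 : 0 < s).
Hypothesis a_norm : 1 <= a 1%N.
Hypothesis a_nondec : forall i t, (1 <= i)%N -> (i <= t)%N -> a i <= a t.
Hypothesis C_meas : forall t, (1 <= t <= T)%N -> <<s C t >> `<=` measurable.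
Hypothesis g_adapted : forall t i k, (1 <= t <= T)%N -> (1 <= i < t)%N ->
  submeasurable (C t) (fun w => g i w ord0 k).
Hypothesis h_adapted : forall t k, (1 <= t <= T)%N ->
  submeasurable (C t) (fun w => h t w ord0 k).
Hypothesis h_bounded : forall t k w, (1 <= t <= T)%N -> `|h t w ord0 k| <= s.
Hypothesis g_L1 : forall t k, (1 <= t <= T)%N -> L1 P (fun w => g t w ord0 k).
Hypothesis g2_L1 : forall t k, (1 <= t <= T)%N -> L1 P (fun w => g t w ord0 k ^+ 2).
Hypothesis g_mean : forall t k Z (M : R), (1 <= t <= T)%N -> submeasurable (C t) Z ->
  (forall w, `|Z w| <= M) ->
  mean P (fun w => Z w * g t w ord0 k) = mean P (fun w => Z w * h t w ord0 k).
Hypothesis g_second : forall t Z (M : R), (1 <= t <= T)%N -> submeasurable (C t) Z ->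
  (forall w, 0 <= Z w <= M) ->
  mean P (fun w => Z w * sqnorm (g t w)) <= s ^+ 2 * mean P Z.

(* The surrogate second moment replaces the current squared gradient by the bound
   [s ^+ 2], so that [weight t] is measurable with respect to the past. *)
Definition surrogate t k w : R :=
  (\sum_(1 <= i < t) a i * g i w ord0 k ^+ 2 + a t * s ^+ 2) / abar a t.

Definition weight t k w : R := (Num.sqrt (surrogate t k w) + eps)^-1.

Definition ratio t k w : R :=
  a t * g t w ord0 k ^+ 2 / (\sum_(1 <= i < t.+1) a i * g i w ord0 k ^+ 2 + eps ^+ 2).

Definition log_argument : R := 1 + s ^+ 2 / eps ^+ 2 * \sum_(1 <= t < T.+1) a t.

(** The tangent is taken at a nonrandom point that bounds the mean of the random argument, so its
    linear part has nonpositive expectation. *)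
Definition log_tangent k w : R :=
  ln log_argument
  + ((1 + (\sum_(1 <= t < T.+1) a t * g t w ord0 k ^+ 2) / eps ^+ 2) / log_argument - 1).

Let a_ge0 t : (1 <= t)%N -> 0 <= a t.
Proof. by move=> t1; apply: le_trans (weight_ge1 a_norm a_nondec t1). Qed.

Let weighted_sum_ge0 (b : nat -> R) t : (forall i, 0 <= b i) ->
  0 <= \sum_(1 <= i < t) a i * b i.
Proof.
move=> b0; rewrite big_nat; apply: sumr_ge0 => i /andP[i1 _].
by rewrite mulr_ge0 // a_ge0.
Qed.

Let eps2 : 0 < eps ^+ 2. Proof. exact: exprn_gt0. Qed.

Let log_argument_gt0 : 0 < log_argument.
Proof.
rewrite ltr_pwDl // mulr_ge0 // ?divr_ge0 ?sqr_ge0 //.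
by rewrite big_nat; apply: sumr_ge0 => i /andP[i1 _]; exact: a_ge0.
Qed.

Lemma weight_gt0 t k w : 0 < weight t k w.
Proof. by rewrite invr_gt0 ltr_wpDl ?sqrtr_ge0. Qed.

Lemma weight_le t k w : weight t k w <= eps^-1.
Proof.
by rewrite lef_pV2 ?posrE // ?lerDr ?sqrtr_ge0 // ltr_wpDl ?sqrtr_ge0.
Qed.

Lemma weight_adapted t k : (1 <= t <= T)%N -> submeasurable (C t) (weight t k).
Proof.
move=> tT; apply: (measurableT_comp (measurable_inv_sqrtD eps_gt0)).
apply: measurable_funM => //; apply: measurable_funD => //.
apply: measurable_sum_nat => i it; apply: measurable_funM => //.
by apply: measurable_funX; exact: g_adapted.
Qed.

(** The descent inequality is divided by [eta], its left side bounded below by [step_decorrelate]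
    and its squares above by [step_sqr_le]. What remains on the left is affine in [g] and its
    square, with coefficients known from the past. *)
Lemma descent_pointwise (eta K D0 : R) w : 0 < eta -> 0 <= K ->
  \sum_(1 <= t < T.+1) \sum_(k < n)
    h t w ord0 k * (adausm_step eta eps a (fun i => g i w) t k * g t w ord0 k) <=
  D0 + K * \sum_(1 <= t < T.+1) \sum_(k < n)
    (adausm_step eta eps a (fun i => g i w) t k * g t w ord0 k) ^+ 2 ->
  \sum_(1 <= t < T.+1) \sum_(k < n)
    (h t w ord0 k * weight t k w * g t w ord0 k
     - (4 * s ^+ 2)^-1 * (s ^+ 2 * (h t w ord0 k ^+ 2 * weight t k w)
         + h t w ord0 k ^+ 2 * weight t k w * g t w ord0 k ^+ 2)) <=
  D0 / eta + (K * eta + s) * \sum_(k < n) log_tangent k w.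
Proof.
move=> eta0 K0 desc.
pose p t k := Num.sqrt ((\sum_(1 <= i < t) a i * g i w ord0 k ^+ 2
  + a t * g t w ord0 k ^+ 2) / abar a t) + eps.
have stepE t k : (1 <= t)%N ->
    adausm_step eta eps a (fun i => g i w) t k * g t w ord0 k = eta * (g t w ord0 k / p t k).
  move=> t1; rewrite /adausm_step /p big_nat_recr //= [_^-1 * _]mulrC.
  by rewrite -mulrA [_^-1 * _]mulrC.
pose S := \sum_(1 <= t < T.+1) \sum_(k < n) ratio t k w.
have S_le : S <= \sum_(k < n) log_tangent k w.
  rewrite /S exchange_big; apply: ler_sum => k _.
  (* Nothing is known about the sign of [a 0]; the value 0 there makes [b] nonnegative at every
     index. *)
  pose b t := if (1 <= t)%N then a t * g t w ord0 k ^+ 2 else 0.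
  have b0 t : 0 <= b t.
    by rewrite /b; case: ifP => // t1; rewrite mulr_ge0 ?sqr_ge0 ?a_ge0.
  have := sum_ratio_le T eps2 log_argument_gt0 b0.
  have E t : \sum_(1 <= i < t) b i = \sum_(1 <= i < t) a i * g i w ord0 k ^+ 2.
    by rewrite !big_nat; apply: eq_bigr => i /andP[i1 _]; rewrite /b i1.
  rewrite E; apply: le_trans; rewrite !big_nat le_eqVlt; apply/orP; left; apply/eqP.
  by apply: eq_bigr => t /andP[t1 _]; rewrite /ratio E /b t1.
have S1 : \sum_(1 <= t < T.+1) \sum_(k < n)
    (adausm_step eta eps a (fun i => g i w) t k * g t w ord0 k) ^+ 2 <= eta ^+ 2 * S.
  rewrite /S mulr_sumr !big_nat; apply: ler_sum => t /andP[t1 _].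
  rewrite mulr_sumr; apply: ler_sum => k _.
  rewrite stepE // exprMn ler_wpM2l ?sqr_ge0 //.
  have := step_sqr_le (g t w ord0 k) (weighted_sum_ge0 t (fun i => sqr_ge0 (g i w ord0 k)))
    (abar_ge1 a_norm a_nondec t1) (abar_le a_nondec t1) eps_gt0.
  by rewrite /ratio (@big_nat_recr _ _ _ t).
have S2 : \sum_(1 <= t < T.+1) \sum_(k < n)
    (h t w ord0 k * weight t k w * g t w ord0 k
     - (4 * s ^+ 2)^-1 * (s ^+ 2 * (h t w ord0 k ^+ 2 * weight t k w)
         + h t w ord0 k ^+ 2 * weight t k w * g t w ord0 k ^+ 2)) - s * S <=
  eta^-1 * \sum_(1 <= t < T.+1) \sum_(k < n)
    h t w ord0 k * (adausm_step eta eps a (fun i => g i w) t k * g t w ord0 k).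
  rewrite /S !mulr_sumr -sumrB !big_nat; apply: ler_sum => t /andP[t1 _].
  rewrite !mulr_sumr -sumrB; apply: ler_sum => k _.
  rewrite stepE //.
  have := step_decorrelate (g t w ord0 k) (weighted_sum_ge0 t (fun i => sqr_ge0 (g i w ord0 k)))
    (abar_ge1 a_norm a_nondec t1) (abar_le a_nondec t1) s_gt0 eps_gt0 (h t w ord0 k).
  have -> : eta^-1 * (h t w ord0 k * (eta * (g t w ord0 k / p t k))) =
    h t w ord0 k * g t w ord0 k / p t k.
    by rewrite mulrCA mulKf ?gt_eqF // mulrA.
  apply: le_trans; rewrite /ratio (@big_nat_recr _ _ _ t) //= lerD2r.
  rewrite -[(Num.sqrt _ + eps)^-1]/(weight t k w) le_eqVlt; apply/orP; left; apply/eqP.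
  by field; rewrite gt_eqF.
have S3 : eta^-1 * \sum_(1 <= t < T.+1) \sum_(k < n)
    h t w ord0 k * (adausm_step eta eps a (fun i => g i w) t k * g t w ord0 k) <=
    D0 / eta + K * eta * S.
  have -> : D0 / eta + K * eta * S = eta^-1 * (D0 + K * (eta ^+ 2 * S)).
    by field; rewrite gt_eqF.
  rewrite ler_wpM2l ?invr_ge0 ?(ltW eta0) //; apply: le_trans desc _.
  by rewrite lerD2l ler_wpM2l.
have S4 : (K * eta + s) * S <= (K * eta + s) * \sum_(k < n) log_tangent k w.
  by rewrite ler_wpM2l // addr_ge0 ?mulr_ge0 // ltW.
by rewrite mulrDl in S4 *; lra.
Qed.

Let h2w_bound t k w : (1 <= t <= T)%N ->
  0 <= h t w ord0 k ^+ 2 * weight t k w <= s ^+ 2 / eps.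
Proof.
move=> tT; rewrite mulr_ge0 ?sqr_ge0 ?(ltW (weight_gt0 _ _ _)) //=.
apply: ler_pM; rewrite ?sqr_ge0 ?(ltW (weight_gt0 _ _ _)) ?weight_le //.
by rewrite -[h _ _ _ _ ^+ 2]real_normK ?num_real // ler_sqr ?nnegrE ?(ltW s_gt0) // h_bounded.
Qed.

Let h2w_adapted t k : (1 <= t <= T)%N ->
  submeasurable (C t) (fun w => h t w ord0 k ^+ 2 * weight t k w).
Proof.
move=> tT; apply: measurable_funM; last exact: weight_adapted.
by apply: measurable_funX; exact: h_adapted.
Qed.

Let h2w_L1 t k : (1 <= t <= T)%N -> L1 P (fun w => h t w ord0 k ^+ 2 * weight t k w).
Proof.
move=> tT; apply: (@L1_bounded _ _ _ P _ (s ^+ 2 / eps)).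
  exact: (submeasurable_measurable (C_meas tT) (h2w_adapted k tT)).
by move=> w; have /andP[? ?] := h2w_bound k w tT; rewrite ger0_norm.
Qed.

Let sqnorm_L1 t : (1 <= t <= T)%N -> L1 P (fun w => sqnorm (g t w)).
Proof. by move=> tT; apply: L1_sum => k _; exact: g2_L1. Qed.

Lemma mean_sqnorm_le t : (1 <= t <= T)%N -> mean P (fun w => sqnorm (g t w)) <= s ^+ 2.
Proof.
move=> tT; have := @g_second t (fun=> 1) 1 tT (measurable_cst _).
rewrite mean_cst mulr1; under [X in mean P X <= _]eq_fun do rewrite mul1r.
by apply => w; rewrite ler01 lexx.
Qed.

Lemma mean_coord_sqr_le t k Z (M : R) : (1 <= t <= T)%N -> submeasurable (C t) Z ->
  (forall w, 0 <= Z w <= M) ->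
  mean P (fun w => Z w * g t w ord0 k ^+ 2) <= s ^+ 2 * mean P Z.
Proof.
move=> tT mZ ZM; apply: le_trans (g_second tT mZ ZM).
have mZ' := submeasurable_measurable (C_meas tT) mZ.
have bZ w : `|Z w| <= M by have /andP[? ?] := ZM w; rewrite ger0_norm.
apply: le_mean => [||w].
- exact: (L1M mZ' bZ (g2_L1 k tT)).
- exact: (L1M mZ' bZ (sqnorm_L1 tT)).
- rewrite ler_wpM2l //; first by case/andP: (ZM w).
  by rewrite /sqnorm (bigD1 k) //= lerDl; apply: sumr_ge0 => i _; exact: sqr_ge0.
Qed.

Lemma log_tangent_L1 k : L1 P (log_tangent k).
Proof.
apply: L1D; first exact: L1_cst.
apply: L1B; last exact: L1_cst.
apply: L1Zr; apply: L1D; first exact: L1_cst.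
apply: L1Zr; under eq_fun do rewrite big_nat.
by apply: L1_sum => t tT; apply: L1Zl; exact: g2_L1.
Qed.

(** The weighted sum of squares has mean at most [eps ^+ 2 * (log_argument - 1)], exactly what makes
    the linear part of the tangent nonpositive in mean. *)
Lemma mean_log_tangent_le k : mean P (log_tangent k) <= ln log_argument.
Proof.
have LV : L1 P (fun w => \sum_(1 <= t < T.+1) a t * g t w ord0 k ^+ 2).
  under eq_fun do rewrite big_nat.
  by apply: L1_sum => t tT; apply: L1Zl; exact: g2_L1.
set V := fun w => _ in LV.
have EV : mean P V <= s ^+ 2 * \sum_(1 <= t < T.+1) a t.
  rewrite /V; under [X in mean P X]eq_fun do rewrite big_nat.
  rewrite mean_sum => [|t tT]; last by apply: L1Zl; exact: g2_L1.
  rewrite mulr_sumr [leRHS]big_nat; apply: ler_sum => t tT.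
  rewrite meanZl; last exact: g2_L1.
  rewrite [leRHS]mulrC ler_wpM2l ?a_ge0 //; first by case/andP: tT.
  have := @mean_coord_sqr_le t k (fun=> 1) 1 tT (measurable_cst _).
  rewrite mean_cst mulr1; under [X in mean P X <= _]eq_fun do rewrite mul1r.
  by apply => w; rewrite ler01 lexx.
have A0 := log_argument_gt0.
have -> : mean P (log_tangent k) = mean P (fun w =>
    (ln log_argument - 1 + log_argument^-1) + (eps ^+ 2 * log_argument)^-1 * V w).
  apply: eq_Rintegral => w _; rewrite /log_tangent -/(V w).
  by field; rewrite !gt_eqF.
rewrite meanD ?mean_cst ?meanZl //; [|exact: L1_cst|exact: L1Zl].
have : (eps ^+ 2 * log_argument)^-1 * mean P V <=
    (eps ^+ 2 * log_argument)^-1 * (s ^+ 2 * \sum_(1 <= t < T.+1) a t).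
  by rewrite ler_wpM2l // invr_ge0 ltW // mulr_gt0.
have -> : (eps ^+ 2 * log_argument)^-1 * (s ^+ 2 * \sum_(1 <= t < T.+1) a t) =
    1 - log_argument^-1.
  have E : s ^+ 2 * \sum_(1 <= t < T.+1) a t = eps ^+ 2 * (log_argument - 1).
    by rewrite /log_argument; field; rewrite gt_eqF.
  by rewrite E; field; rewrite !gt_eqF.
by lra.
Qed.

(** Conditioning on the past turns [g] into [h] in the first term and bounds its square by [s ^+ 2]
    in the last. The correction is then at most [(s ^+ 2 + s ^+ 2) / (4 * s ^+ 2)], one half, of the
    main term. *)
Lemma mean_decorrelated t k : (1 <= t <= T)%N ->
  let X w := h t w ord0 k * weight t k w * g t w ord0 k
     - (4 * s ^+ 2)^-1 * (s ^+ 2 * (h t w ord0 k ^+ 2 * weight t k w)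
         + h t w ord0 k ^+ 2 * weight t k w * g t w ord0 k ^+ 2) in
  L1 P X /\ mean P (fun w => h t w ord0 k ^+ 2 * weight t k w) / 2 <= mean P X.
Proof.
move=> tT X.
pose Z1 w := h t w ord0 k * weight t k w.
pose Z2 w := h t w ord0 k ^+ 2 * weight t k w.
have mZ1 : submeasurable (C t) Z1.
  by apply: measurable_funM; [exact: h_adapted|exact: weight_adapted].
have bZ1 w : `|Z1 w| <= s / eps.
  rewrite normrM; apply: ler_pM => //; first exact: h_bounded.
  by rewrite gtr0_norm ?weight_gt0 // weight_le.
have mZ1' := submeasurable_measurable (C_meas tT) mZ1.
have mZ2' := submeasurable_measurable (C_meas tT) (h2w_adapted k tT).
have bZ2 w : `|Z2 w| <= s ^+ 2 / eps.
  by have /andP[? ?] := h2w_bound k w tT; rewrite ger0_norm.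
have LZ1g := L1M mZ1' bZ1 (g_L1 k tT).
have LZ2g := L1M mZ2' bZ2 (g2_L1 k tT).
have LZ2 := h2w_L1 k tT.
have LZ2s : L1 P (fun w => s ^+ 2 * Z2 w + Z2 w * g t w ord0 k ^+ 2).
  by apply: L1D => //; exact: L1Zl.
split; first by apply: L1B => //; exact: L1Zl.
rewrite /X meanB ?meanZl ?meanD ?meanZl //; [|exact: L1Zl|exact: L1Zl].
rewrite (g_mean k tT mZ1 bZ1).
have -> : mean P (fun w => Z1 w * h t w ord0 k) = mean P Z2.
  by apply: eq_Rintegral => w _; rewrite /Z1 /Z2; ring.
have := mean_coord_sqr_le k tT (h2w_adapted k tT) (fun w => h2w_bound k w tT).
rewrite -/Z2; set m2 := mean P Z2; set m3 := mean P _ => m3le.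
have : (4 * s ^+ 2)^-1 * (s ^+ 2 * m2 + m3) <= (4 * s ^+ 2)^-1 * (s ^+ 2 * m2 + s ^+ 2 * m2).
  by rewrite ler_wpM2l ?lerD2l // invr_ge0 mulr_ge0 // sqr_ge0.
have -> : (4 * s ^+ 2)^-1 * (s ^+ 2 * m2 + s ^+ 2 * m2) = m2 / 2 by field; rewrite gt_eqF.
by lra.
Qed.

Lemma sum_mean_grad_le (eta K D0 : R) : 0 < eta -> 0 <= K ->
  {ae P, forall w, \sum_(1 <= t < T.+1) \sum_(k < n)
    h t w ord0 k * (adausm_step eta eps a (fun i => g i w) t k * g t w ord0 k) <=
  D0 + K * \sum_(1 <= t < T.+1) \sum_(k < n)
    (adausm_step eta eps a (fun i => g i w) t k * g t w ord0 k) ^+ 2} ->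
  \sum_(1 <= t < T.+1) \sum_(k < n) mean P (fun w => h t w ord0 k ^+ 2 * weight t k w) <=
  2 * (D0 / eta + (K * eta + s) * (n%:R * ln log_argument)).
Proof.
move=> eta0 K0 desc.
pose X t k w := h t w ord0 k * weight t k w * g t w ord0 k
     - (4 * s ^+ 2)^-1 * (s ^+ 2 * (h t w ord0 k ^+ 2 * weight t k w)
         + h t w ord0 k ^+ 2 * weight t k w * g t w ord0 k ^+ 2).
have LX t : (1 <= t <= T)%N -> L1 P (fun w => \sum_(k < n) X t k w).
  by move=> tT; apply: L1_sum => k _; have [] := mean_decorrelated k tT.
have LS : L1 P (fun w => \sum_(k < n) log_tangent k w).
  by apply: L1_sum => k _; exact: log_tangent_L1.
have : mean P (fun w => \sum_(1 <= t < T.+1) \sum_(k < n) X t k w) <=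
       mean P (fun w => D0 / eta + (K * eta + s) * \sum_(k < n) log_tangent k w).
  apply: ae_le_mean.
  - by under eq_fun do rewrite big_nat; exact: L1_sum.
  - by apply: L1D; [exact: L1_cst|exact: L1Zl].
  - by apply: filterS desc => w; exact: descent_pointwise.
under [X in mean P X <= _]eq_fun do rewrite big_nat.
rewrite mean_sum // meanD ?mean_cst ?meanZl //; [|exact: L1_cst|exact: L1Zl].
rewrite mean_sum => [|k _]; last exact: log_tangent_L1.
have : \sum_(k < n) mean P (log_tangent k) <= n%:R * ln log_argument.
  have -> : n%:R * ln log_argument = \sum_(k < n) ln log_argument.
    by rewrite sumr_const card_ord mulr_natl.
  by apply: ler_sum => k _; exact: mean_log_tangent_le.
have Ks : 0 <= K * eta + s by rewrite addr_ge0 ?mulr_ge0 // ltW.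
move=> /(ler_wpM2l Ks) h1 h2.
have : (\sum_(1 <= t < T.+1) \sum_(k < n) mean P (fun w => h t w ord0 k ^+ 2 * weight t k w)) / 2
  <= \sum_(1 <= t < T.+1 | (1 <= t < T.+1)%N) mean P (fun w => \sum_(k < n) X t k w).
  rewrite big_nat mulr_suml; apply: ler_sum => t tT.
  rewrite mean_sum => [|k _]; last by have [] := mean_decorrelated k tT.
  by rewrite mulr_suml; apply: ler_sum => k _; have [] := mean_decorrelated k tT.
by lra.
Qed.

(** The surrogates of all coordinates are majorized by one quantity [D], built from full squared
    norms. Young's inequality is then applied once, to the norm, with the common weight [u], and [D]
    has mean at most [s ^+ 2 * T%:R]. *)
Lemma mean_powR43_le t (c : R) : (1 <= t <= T)%N -> 0 < c ->
  mean P (fun w => enorm (h t w) `^ (4 / 3)) <=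
  2 / 3 * (c * \sum_(k < n) mean P (fun w => h t w ord0 k ^+ 2 * weight t k w))
  + 3^-1 * ((2 * eps ^+ 2 + 2 * s ^+ 2 * T%:R) / c ^+ 2).
Proof.
move=> tT c0; have /andP[t1 tleT] := tT.
have ab1 := abar_ge1 a_norm a_nondec t1.
have ab0 : 0 < abar a t by apply: lt_le_trans ab1.
pose D w := (\sum_(1 <= i < t) a i * sqnorm (g i w) + a t * s ^+ 2) / abar a t.
have D0 w : 0 <= D w.
  rewrite divr_ge0 ?(ltW ab0) // addr_ge0 ?(mulr_ge0 (a_ge0 t1)) ?sqr_ge0 //.
  by apply: weighted_sum_ge0 => i; exact: sqnorm_ge0.
have surD k w : surrogate t k w <= D w.
  rewrite ler_wpM2r ?invr_ge0 ?(ltW ab0) // lerD2r !big_nat; apply: ler_sum => i /andP[i1 _].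
  rewrite ler_wpM2l ?a_ge0 //.
  by rewrite /sqnorm (bigD1 k) //= lerDl; apply: sumr_ge0 => j _; exact: sqr_ge0.
have iT i : (1 <= i < t)%N -> (1 <= i <= T)%N.
  by case/andP=> -> it /=; exact: leq_trans (ltnW it) tleT.
have LD : L1 P D.
  apply: L1Zr; apply: L1D; last exact: L1_cst.
  under eq_fun do rewrite big_nat.
  by apply: L1_sum => i /iT iT'; apply: L1Zl; exact: sqnorm_L1.
(* The weights up to time [t] add up to [t%:R * abar a t], so the normalization leaves
   [s ^+ 2 * t%:R]. *)
have ED : mean P D <= s ^+ 2 * T%:R.
  have LDs : L1 P (fun w => \sum_(1 <= i < t) a i * sqnorm (g i w)).
    under eq_fun do rewrite big_nat.
    by apply: L1_sum => i /iT iT'; apply: L1Zl; exact: sqnorm_L1.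
  rewrite /D meanZr ?meanD ?mean_cst //;
    [|exact: L1_cst|by apply: L1D => //; exact: L1_cst].
  apply: (@le_trans _ _ (s ^+ 2 * t%:R)); last by rewrite ler_wpM2l ?sqr_ge0 // ler_nat.
  rewrite ler_pdivrMr //.
  have -> : s ^+ 2 * t%:R * abar a t = \sum_(1 <= i < t) a i * s ^+ 2 + a t * s ^+ 2.
    rewrite -(@big_nat_recr _ _ _ t 1 (fun i => a i * s ^+ 2)) // -mulr_suml /abar.
    by field; rewrite gt_eqF // ltr0n.
  rewrite lerD2r; under [X in mean P X]eq_fun do rewrite big_nat.
  rewrite mean_sum => [|i /iT iT']; last by apply: L1Zl; exact: sqnorm_L1.
  rewrite [leRHS]big_nat; apply: ler_sum => i it; have iT' := iT i it.
  rewrite meanZl; last exact: sqnorm_L1.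
  rewrite ler_wpM2l ?mean_sqnorm_le //; apply: a_ge0; by case/andP: it.
have LS : L1 P (fun w => \sum_(k < n) h t w ord0 k ^+ 2 * weight t k w).
  by apply: L1_sum => k _; exact: h2w_L1.
have point w : enorm (h t w) `^ (4 / 3) <=
    2 / 3 * (c * \sum_(k < n) h t w ord0 k ^+ 2 * weight t k w)
    + 3^-1 * ((2 * eps ^+ 2 + 2 * D w) / c ^+ 2).
  pose u := (Num.sqrt (D w) + eps)^-1.
  have sq0 : 0 < Num.sqrt (D w) + eps by rewrite ltr_wpDl ?sqrtr_ge0.
  have u0 : 0 < u by rewrite invr_gt0.
  apply: le_trans (powR43_young (enorm_ge0 _) u0 c0) _.
  apply: lerD.
    rewrite ler_wpM2l // ler_wpM2l ?(ltW c0) // enorm_sqr /sqnorm mulr_suml.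
    apply: ler_sum => k _; rewrite ler_wpM2l ?sqr_ge0 //.
    rewrite /u /weight lef_pV2 ?posrE // ?lerD2r ?ler_wsqrtr //.
    by rewrite ltr_wpDl ?sqrtr_ge0.
  rewrite ler_wpM2l ?invr_ge0 // ler_wpM2r ?invr_ge0 ?sqr_ge0 //.
  (* The inverse square of [u] is the square of a sum, at most twice the sum of the squares. *)
  rewrite /u exprVn invrK -subr_ge0.
  have -> : 2 * eps ^+ 2 + 2 * D w - (Num.sqrt (D w) + eps) ^+ 2 = (Num.sqrt (D w) - eps) ^+ 2.
    by rewrite -{1}(sqr_sqrtr (D0 w)); ring.
  exact: sqr_ge0.
have Lbd : L1 P (fun w => 2 / 3 * (c * \sum_(k < n) h t w ord0 k ^+ 2 * weight t k w)
    + 3^-1 * ((2 * eps ^+ 2 + 2 * D w) / c ^+ 2)).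
  apply: L1D; first by do 2 apply: L1Zl.
  by apply: L1Zl; apply: L1Zr; apply: L1D; [exact: L1_cst|exact: L1Zl].
have mh : measurable_fun setT (fun w => enorm (h t w) `^ (4 / 3)).
  apply: (measurableT_comp (measurable_powR _)); apply: measurable_enorm => k.
  exact: (submeasurable_measurable (C_meas tT) (h_adapted k tT)).
apply: (@le_trans _ _ (mean P (fun w =>
    2 / 3 * (c * \sum_(k < n) h t w ord0 k ^+ 2 * weight t k w)
    + 3^-1 * ((2 * eps ^+ 2 + 2 * D w) / c ^+ 2)))).
  apply: le_mean => //; apply: L1_le Lbd => // w.
  by rewrite ger0_norm ?powR_ge0.
have L2D : L1 P (fun w => 2 * eps ^+ 2 + 2 * D w) by apply: L1D; [exact: L1_cst|exact: L1Zl].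
rewrite meanD; [|by do 2 apply: L1Zl|by apply: L1Zl; exact: L1Zr].
rewrite !meanZl //; [|exact: L1Zr|exact: L1Zl].
rewrite meanZr // meanD ?mean_cst ?meanZl //; [|exact: L1_cst|exact: L1Zl].
rewrite mean_sum => [|k _]; last exact: h2w_L1.
rewrite lerD2l ler_wpM2l ?invr_ge0 // ler_wpM2r ?invr_ge0 ?sqr_ge0 // lerD2l.
by rewrite -mulrA ler_wpM2l.
Qed.

(** The bounds at the single times share the same [c]; averaging them puts [B / T%:R] in the role of
    the linear coefficient before [c] is chosen. *)
Lemma average_powR_le (B : R) : (0 < T)%N ->
  \sum_(1 <= t < T.+1) \sum_(k < n) mean P (fun w => h t w ord0 k ^+ 2 * weight t k w) <= B ->
  (T%:R^-1 * \sum_(1 <= t < T.+1) mean P (fun w => enorm (h t w) `^ (4 / 3))) `^ (3 / 2) <=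
  Num.sqrt (2 * eps ^+ 2 + 2 * s ^+ 2 * T%:R) / T%:R * B.
Proof.
move=> T0 hB; have T0' : 0 < T%:R :> R by rewrite ltr0n.
set Q := 2 * eps ^+ 2 + 2 * s ^+ 2 * T%:R.
have Q0 : 0 < Q.
  apply: ltr_pwDl; first by rewrite mulr_gt0.
  by rewrite mulr_ge0 // mulr_ge0 // sqr_ge0.
have B0 : 0 <= B.
  apply: le_trans hB; rewrite big_nat; apply: sumr_ge0 => t tT; apply: sumr_ge0 => k _.
  by apply: mean_ge0 => w; case/andP: (h2w_bound k w tT).
rewrite -mulrA [_^-1 * B]mulrC; apply: powR32_optimize => //.
- rewrite mulr_ge0 ?invr_ge0 ?(ltW T0') //; apply: sumr_ge0 => t _.
  by apply: mean_ge0 => w; exact: powR_ge0.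
- by rewrite divr_ge0 // ltW.
move=> c c0; rewrite [leLHS]mulrC ler_pdivrMr //.
set q := 3^-1 * (Q / c ^+ 2).
have -> : (2 / 3 * (c * (B / T%:R)) + q) * T%:R = 2 / 3 * (c * B) + T%:R * q.
  by field; rewrite !gt_eqF.
apply: (@le_trans _ _ (\sum_(1 <= t < T.+1) (2 / 3 * (c * \sum_(k < n)
   mean P (fun w => h t w ord0 k ^+ 2 * weight t k w)) + q))).
  by rewrite !big_nat; apply: ler_sum => t tT; exact: mean_powR43_le.
rewrite big_split /= sumr_const_nat subSS subn0 -[q *+ T]mulr_natl -!mulr_sumr.
by rewrite lerD2r ler_wpM2l // ler_wpM2l // ltW.
Qed.

End core.

(** * AdaUSM *)

Section versions.
Context {d : measure_display} {Omega : measurableType d} {R : realType}.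
Variable P : probability Omega R.

Lemma mean_indic (A : set Omega) : measurable A -> mean P (\1_A) = fine (P A).
Proof. by move=> mA; rewrite /mean /Rintegral integral_indic // setIT. Qed.

Lemma mean_indicM (A B : set Omega) : measurable A -> measurable B ->
  mean P (fun w => \1_A w * \1_B w) = fine (P (A `&` B)).
Proof. by move=> mA mB; rewrite -mean_indic ?indicI //; exact: measurableI. Qed.

Lemma cond_expectation_mean (C : set_system Omega) (X Y : Omega -> R) :
  cond_expectation P <<s C >> X Y ->
  [/\ L1 P X, L1 P Y, submeasurable C Y &
      forall A, <<s C >> A ->
        mean P (fun w => \1_A w * X w) = mean P (fun w => \1_A w * Y w)].
Proof.
move=> [LX LY mY XY]; split => //.
- by move=> _ B mB; rewrite setTI; exact: mY.
- by move=> A CA; rewrite !mean_restrict /Rintegral XY.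
Qed.

(** A countable intersection of almost sure events; the ordinal is passed through its value to be
    quantified over the naturals. *)
Lemma ae_forall_ord (T n : nat) (Q : nat -> 'I_n -> Omega -> Prop) :
  (forall t k, (1 <= t <= T)%N -> {ae P, forall w, Q t k w}) ->
  {ae P, forall w, forall t k, (1 <= t <= T)%N -> Q t k w}.
Proof.
move=> hQ; apply/ae_foralln => t.
case: (boolP (1 <= t <= T)%N) => [tT|_]; last exact: aeW.
suff : {ae P, forall w, forall j, forall k : 'I_n, val k = j -> Q t k w}.
  by apply: filterS => w hw k _; exact: (hw (val k)).
apply/ae_foralln => j; case: (ltnP j n) => [jn|nj].
  apply: filterS (hQ t (Ordinal jn) tT) => w hw k kj.
  by rewrite (_ : k = Ordinal jn) //; exact: val_inj.
by apply: aeW => w k kj; have := ltn_ord k; rewrite -kj ltnNge in nj *; rewrite nj.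
Qed.

Lemma sum_nat_pick (F I : nat -> R) (j T : nat) : (1 <= j <= T)%N -> I j = 1 ->
  (forall t, t != j -> I t = 0) -> \sum_(1 <= t < T.+1) F t * I t = F j.
Proof.
move=> jT Ij It; rewrite (bigD1_seq j) ?iota_uniq //=; last by rewrite mem_index_iota.
by rewrite Ij mulr1 big1 ?addr0 // => t tj; rewrite It // mulr0.
Qed.

Lemma sigma_of_measurable d' (S : measurableType d') (D : set nat) (X : nat -> Omega -> S) :
  (forall i, D i -> measurable_fun setT (X i)) -> sigma_family D X `<=` measurable.
Proof.
move=> mX; apply: smallest_sub; first exact: sigma_algebra_measurable.
by move=> A [i Di [B mB <-]]; exact: mX.
Qed.

Lemma sigma_family_gen d' (S : measurableType d') (D : set nat) (X : nat -> Omega -> S) i :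
  D i -> measurable_fun setT
    (X i : g_sigma_algebraType (\bigcup_(j in D) sigma_of (X j)) -> S).
Proof.
by move=> Di _ B mB; apply: sub_gen_smallest; exists i => //; exists B.
Qed.

Lemma sigma_family_sub d' (S : measurableType d') (D : set nat) (X : nat -> Omega -> S)
    (C : set_system Omega) :
  (forall i, D i -> measurable_fun setT (X i : g_sigma_algebraType C -> S)) ->
  sigma_family D X `<=` <<s C >>.
Proof.
move=> mX; apply: smallest_sub; first exact: smallest_sigma_algebra.
by move=> A [i Di [B mB <-]]; exact: (mX i Di measurableT).
Qed.

End versions.

(** * Convergence rate along the random runs *)

Section adausm_analysis.
Context {R : realType}.
Variables (n : nat) (hn : (0 < n)%N) (f : 'rV[R]_n -> R^o) (L : R).
Hypothesis f_diff : forall y, differentiable f y.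
Hypothesis f_smooth : forall y z : 'rV[R]_n,
  enorm (gradient f y - gradient f z) <= L * enorm (y - z).
Hypothesis f_lb : has_lbound (range f).
Variables (eta eps mu lambda sigma : R) (a : nat -> R) (T : nat).
Hypotheses (eta_gt0 : 0 < eta) (eps_gt0 : 0 < eps) (mu_ge0 : 0 <= mu) (mu_lt1 : mu < 1).
Hypotheses (lambda_ge0 : 0 <= lambda) (lambda_le : lambda <= 1 / (1 - mu)).
Hypothesis sigma_ge0 : 0 <= sigma.
Hypothesis a_nondec : forall s t, (1 <= s)%N -> (s <= t)%N -> a s <= a t.
Hypothesis a_norm : 1 <= a 1%N.
Hypothesis T_gt0 : (0 < T)%N.
Context {d : measure_display} {Omega : measurableType d} (P : probability Omega R).
Context {d' : measure_display} {Xi : measurableType d'} (xi : nat -> Omega -> Xi).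
Hypothesis xi_meas : forall t, (1 <= t)%N -> measurable_fun setT (xi t).
Variable G : nat -> 'rV[R]_n * Xi -> 'rV[R]_n.
Hypothesis G_meas : forall t, (1 <= t <= T)%N -> measurable_fun setT (G t).
Variable tau : Omega -> nat.
Hypothesis tau_meas : measurable_fun setT tau.
Hypothesis tau_range : forall w, (1 <= tau w <= T)%N.
Hypothesis tau_unif : forall t, (1 <= t <= T)%N -> P (tau @^-1` [set t]) = (T%:R^-1)%:E.
Hypothesis tau_indep : independent_systems P (sigma_of tau)
  (sigma_family [set t | (1 <= t)%N] xi).
Variables (x1 : 'rV[R]_n) (g m x : nat -> Omega -> 'rV[R]_n).
Hypothesis g_sample : forall t w, (1 <= t <= T)%N -> g t w = G t (x t w, xi t w).
Hypothesis run : forall w, adausm_run eta eps mu lambda a x1 T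
  (fun t => g t w) (fun t => m t w) (fun t => x t w).
Hypothesis A1 : forall t (k : 'I_n), (1 <= t <= T)%N ->
  cond_expectation P (sigma_family [set i | (1 <= i < t)%N] g)
    (fun w => g t w ord0 k) (fun w => gradient f (x t w) ord0 k).
Hypothesis A2 : forall t, (1 <= t <= T)%N ->
  exists Y : Omega -> R,
    cond_expectation P (sigma_family [set i | (1 <= i < t)%N] g)
      (fun w => enorm (g t w) ^+ 2) Y /\
    {ae P, forall w, Y w <= sigma ^+ 2}.

(** [past t] generates the conditioning in (A1) and (A2), while [samples] generates everything that
    [tau] is independent of. *)
Let past t : set_system Omega := \bigcup_(i in [set i | (1 <= i < t)%N]) sigma_of (g i).
Let samples : set_system Omega := \bigcup_(i in [set i | (1 <= i)%N]) sigma_of (xi i).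
Let grad t k w := gradient f (x t w) ord0 k.
(* A bounded version of the gradient at [x t], which (A2) bounds by [sigma] almost
   surely. *)
Let h t w : 'rV[R]_n := \row_k clamp sigma (grad t k w).

Let g_L1 t k : (1 <= t <= T)%N -> L1 P (fun w => g t w ord0 k).
Proof. by move=> tT; have [] := cond_expectation_mean (A1 k tT). Qed.

Let grad_L1 t k : (1 <= t <= T)%N -> L1 P (grad t k).
Proof. by move=> tT; have [] := cond_expectation_mean (A1 k tT). Qed.

Let grad_adapted t k : (1 <= t <= T)%N -> submeasurable (past t) (grad t k).
Proof. by move=> tT; have [] := cond_expectation_mean (A1 k tT). Qed.

Let g_meas t : (1 <= t <= T)%N -> measurable_fun setT (g t).
Proof. by move=> tT; apply: measurable_rV => k; exact: L1_measurable (g_L1 k tT). Qed.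

Let past_meas t : (1 <= t <= T)%N -> <<s past t >> `<=` measurable.
Proof.
move=> /andP[_ tT]; apply: sigma_of_measurable => i /andP[i1 it].
by apply: g_meas; rewrite i1 /=; exact: leq_trans (ltnW it) tT.
Qed.

Let g_adapted t i k : (1 <= t <= T)%N -> (1 <= i < t)%N ->
  submeasurable (past t) (fun w => g i w ord0 k).
Proof.
by move=> _ it; apply: (measurableT_comp (measurable_coord k)); exact: sigma_family_gen.
Qed.

Let sqnorm_L1 t : (1 <= t <= T)%N -> L1 P (fun w => sqnorm (g t w)).
Proof.
move=> tT; have [Y [/cond_expectation_mean[LX _ _ _] _]] := A2 tT.
by under eq_fun do rewrite -enorm_sqr.
Qed.

Let coord_sqr_le (v : 'rV[R]_n) k : v ord0 k ^+ 2 <= sqnorm v.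
Proof.
by rewrite /sqnorm (bigD1 k) //= lerDl; apply: sumr_ge0 => i _; exact: sqr_ge0.
Qed.

Let g2_L1 t k : (1 <= t <= T)%N -> L1 P (fun w => g t w ord0 k ^+ 2).
Proof.
move=> tT; apply: (@L1_le _ _ _ _ _ (fun w => sqnorm (g t w))).
- by apply: measurable_funX; exact: L1_measurable (g_L1 k tT).
- by move=> w; rewrite ger0_norm ?sqr_ge0.
- exact: sqnorm_L1.
Qed.

(** Integrated form of (A2): the factor [Z] is moved onto the conditional expectation, where the
    almost sure bound applies. *)
Let g_second t Z (M : R) : (1 <= t <= T)%N -> submeasurable (past t) Z ->
  (forall w, 0 <= Z w <= M) ->
  mean P (fun w => Z w * sqnorm (g t w)) <= sigma ^+ 2 * mean P Z.
Proof.
move=> tT mZ ZM; have [Y [/cond_expectation_mean[LX LY mY XY] Ys]] := A2 tT.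
have bZ w : `|Z w| <= M by have /andP[? ?] := ZM w; rewrite ger0_norm.
have mZ' := submeasurable_measurable (past_meas tT) mZ.
have -> : mean P (fun w => Z w * sqnorm (g t w)) = mean P (fun w => Z w * Y w).
  rewrite -(mean_mul_eq (past_meas tT) LX LY XY mZ bZ).
  by apply: eq_Rintegral => w _; rewrite enorm_sqr.
have LZ : L1 P Z := L1_bounded P mZ' bZ.
rewrite mulrC -meanZr //; apply: ae_le_mean.
- exact: L1M mZ' bZ LY.
- exact: L1Zr.
- by apply: filterS Ys => w Yw; rewrite ler_wpM2l //; case/andP: (ZM w).
Qed.

(** A squared coordinate is at most the squared norm, so (A2) bounds its conditional second moment;
    conditional Jensen then bounds the coordinate of the gradient by [sigma]. *)
Let h_eq_grad : {ae P, forall w, forall t k, (1 <= t <= T)%N -> grad t k w = h t w ord0 k}.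
Proof.
apply: ae_forall_ord => t k tT; have [LX LY mY XY] := cond_expectation_mean (A1 k tT).
have : {ae P, forall w, grad t k w = clamp sigma (grad t k w)}.
  apply: (cond_mean_clamp_ae (past_meas tT) sigma_ge0 LX (g2_L1 k tT)) => // A CA.
  have mA : submeasurable (past t) (\1_A : Omega -> R) by exact: submeasurable_indic.
  have A01 w : 0 <= (\1_A w : R) <= 1.
    by rewrite indicE; case: (_ \in _); rewrite ?ler01 ?lexx.
  apply: le_trans (g_second tT mA A01).
  apply: le_mean => [||w].
  - exact: (L1_indicM (past_meas tT) CA (g2_L1 k tT)).
  - exact: (L1_indicM (past_meas tT) CA (sqnorm_L1 tT)).
  - by rewrite ler_wpM2l //; case/andP: (A01 w).
by apply: filterS => w; rewrite mxE.
Qed.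

Let h_adapted t k : (1 <= t <= T)%N -> submeasurable (past t) (fun w => h t w ord0 k).
Proof.
move=> tT; rewrite /submeasurable; under eq_fun do rewrite mxE.
exact: submeasurable_clamp (grad_adapted k tT).
Qed.

Let h_bounded t k w : `|h t w ord0 k| <= sigma.
Proof. by rewrite mxE norm_clamp_le. Qed.

Let g_mean t k Z (M : R) : (1 <= t <= T)%N -> submeasurable (past t) Z ->
  (forall w, `|Z w| <= M) ->
  mean P (fun w => Z w * g t w ord0 k) = mean P (fun w => Z w * h t w ord0 k).
Proof.
move=> tT mZ bZ; have [LX LY mY XY] := cond_expectation_mean (A1 k tT).
have mZ' := submeasurable_measurable (past_meas tT) mZ.
rewrite (mean_mul_eq (past_meas tT) LX LY XY mZ bZ); apply: ae_eq_mean.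
- by apply: measurable_funM => //; exact: L1_measurable LY.
- apply: measurable_funM => //.
  exact: (submeasurable_measurable (past_meas tT) (h_adapted k tT)).
- by apply: filterS h_eq_grad => w /(_ t k tT) <-.
Qed.

Let Delta := f x1 - inf (range f).
Let K := L * (1 + mu) / (2 * (1 - mu) ^+ 2).

Let run_descent w :
  \sum_(1 <= t < T.+1) \sum_(k < n)
    grad t k w * (adausm_step eta eps a (fun i => g i w) t k * g t w ord0 k) <=
  (1 - mu) * Delta + K * \sum_(1 <= t < T.+1) \sum_(k < n)
    (adausm_step eta eps a (fun i => g i w) t k * g t w ord0 k) ^+ 2.
Proof.
pose D t : 'rV[R]_n := \row_k (adausm_step eta eps a (fun i => g i w) t k * g t w ord0 k).
have [x1E m0E runE] := run w.
have mS t : (1 <= t <= T)%N -> m t w = mu *: m t.-1 w - D t.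
  by move=> tT; apply/rowP => k; have [+ _] := runE t k tT; rewrite !mxE.
have xS t : (1 <= t <= T)%N ->
    x t.+1 w = x t w + m t w + (lambda * mu) *: (m t w - m t.-1 w).
  by move=> tT; apply/rowP => k; have [_ +] := runE t k tT; rewrite !mxE.
have lf y : inf (range f) <= f y by apply: ge_inf => //; exists y.
have := momentum_descent f_diff f_smooth mu_ge0 mu_lt1 lambda_ge0 lambda_le m0E mS xS hn lf.
rewrite x1E -/K -/Delta; congr (_ <= _ + _ * _); apply: eq_bigr => t _.
  by apply: eq_bigr => k _; rewrite [D t _ _]mxE.
by apply: eq_bigr => k _; rewrite [D t _ _]mxE.
Qed.

(** Iterate, momentum and all gradients so far go through one induction, because the step size
    depends on the whole history of gradients. *)
Let iterates_sampled t : (t <= T)%N ->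
  [/\ forall k, submeasurable samples (fun w => x t.+1 w ord0 k),
      forall k, submeasurable samples (fun w => m t w ord0 k) &
      forall i, (1 <= i <= t)%N ->
        measurable_fun setT (g i : g_sigma_algebraType samples -> 'rV[R]_n)].
Proof.
elim: t => [_|t ih tT].
  split => [k|k|i]; last by case: i.
  - by have -> : (fun w => x 1 w ord0 k) = cst (x1 ord0 k);
      [apply/funext => w; have [->] := run w|exact: measurable_cst].
  - by have -> : (fun w => m 0 w ord0 k) = cst 0;
      [apply/funext => w; have [_ -> _] := run w; rewrite mxE|exact: measurable_cst].
have [mx mm mg] := ih (ltnW tT).
have tT' : (1 <= t.+1 <= T)%N by [].
have mgS : measurable_fun setT (g t.+1 : g_sigma_algebraType samples -> 'rV[R]_n).
  have -> : g t.+1 = G t.+1 \o (fun w => (x t.+1 w, xi t.+1 w)).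
    by apply/funext => w; rewrite g_sample.
  apply: (measurableT_comp (G_meas tT')); apply: measurable_fun_pair.
    exact: (@measurable_rV _ _ (g_sigma_algebraType samples)).
  exact: sigma_family_gen.
have mg' i : (1 <= i <= t.+1)%N ->
    measurable_fun setT (g i : g_sigma_algebraType samples -> 'rV[R]_n).
  case/andP=> i1; rewrite leq_eqVlt => /predU1P[->//|it].
  by apply: mg; rewrite i1.
have mgk i k : (1 <= i <= t.+1)%N -> submeasurable samples (fun w => g i w ord0 k).
  by move=> it; apply: (measurableT_comp (measurable_coord k)); exact: mg'.
have mmS k : submeasurable samples (fun w => m t.+1 w ord0 k).
  have -> : (fun w => m t.+1 w ord0 k) = (fun w => mu * m t w ord0 k -
      adausm_step eta eps a (fun i => g i w) t.+1 k * g t.+1 w ord0 k).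
    by apply/funext => w; have [_ _ /(_ t.+1 k tT')[-> _]] := run w.
  apply: measurable_funB; first by apply: measurable_funM => //; exact: mm.
  apply: measurable_funM; last by apply: mgk; rewrite leqnn.
  apply: measurable_funM => //.
  apply: (measurableT_comp (measurable_inv_sqrtD eps_gt0)); apply: measurable_funM => //.
  apply: measurable_sum_nat => i it; apply: measurable_funM => //.
  by apply: measurable_funX; exact: mgk.
split => // k.
have -> : (fun w => x t.+2 w ord0 k) = (fun w => x t.+1 w ord0 k + m t.+1 w ord0 k
    + lambda * mu * (m t.+1 w ord0 k - m t w ord0 k)).
  by apply/funext => w; have [_ _ /(_ t.+1 k tT')[_ ->]] := run w.
apply: measurable_funD; first by apply: measurable_funD; [exact: mx|exact: mmS].
by apply: measurable_funM => //; apply: measurable_funB; [exact: mmS|exact: mm].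
Qed.

(** Measurability is inherited from (A1): the gradient is known from the past, and the past consists
    of functions of the samples. *)
Let h_sampled t k : (1 <= t <= T)%N -> submeasurable samples (fun w => h t w ord0 k).
Proof.
move=> tT _ B mB; have /andP[_ tT'] := tT.
have := h_adapted k tT measurableT mB.
apply: sigma_family_sub => i /andP[i1 it].
have [_ _ mg] := iterates_sampled tT'.
by apply: mg; rewrite i1 ltnW.
Qed.

Let samples_meas : <<s samples >> `<=` measurable.
Proof. by apply: sigma_of_measurable => i; exact: xi_meas. Qed.

Let tau_level t : measurable (tau @^-1` [set t]).
Proof. by rewrite -[X in measurable X]setTI; exact: tau_meas. Qed.

(** By independence and uniformity, the constant [T%:R^-1] is the conditional expectation of the
    indicator given the samples; the bounded factor [Z] is then taken out. *)
Let mean_tau t Z (M : R) : (1 <= t <= T)%N -> submeasurable samples Z ->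
  (forall w, `|Z w| <= M) ->
  mean P (fun w => Z w * \1_(tau @^-1` [set t]) w) = T%:R^-1 * mean P Z.
Proof.
move=> tT mZ bZ.
have LZ := L1_bounded P (submeasurable_measurable samples_meas mZ) bZ.
rewrite mulrC -meanZr //; apply: (mean_mul_eq samples_meas _ _ _ mZ bZ).
- by apply: (L1_bounded P _ (norm_indic_le1 _)); exact: measurable_indic.
- exact: L1_cst.
move=> A CA; have mA := samples_meas CA.
rewrite mean_indicM // setIC tau_indep //; last first.
  by exists [set t] => //; rewrite setTI.
rewrite meanZr; last by apply: (L1_bounded P _ (norm_indic_le1 _)); exact: measurable_indic.
by rewrite mean_indic // tau_unif // fineM ?fin_num_measure //= mulrC.
Qed.

Let phi t w := enorm (h t w) `^ (4 / 3).

Let phi_bound t w : `|phi t w| <= Num.sqrt (n%:R * sigma ^+ 2) `^ (4 / 3).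
Proof.
rewrite ger0_norm ?powR_ge0 //; apply: ge0_ler_powR; rewrite ?nnegrE ?sqrtr_ge0 //.
apply: ler_wsqrtr; rewrite -[X in X%:R * _]card_ord mulr_natl -sumr_const.
apply: ler_sum => k _; rewrite -[h _ _ _ _ ^+ 2]real_normK ?num_real //.
by rewrite ler_sqr ?nnegrE ?h_bounded.
Qed.

Let phi_sampled t : (1 <= t <= T)%N -> submeasurable samples (phi t).
Proof.
move=> tT; apply: (measurableT_comp (measurable_powR _)).
by apply: measurable_enorm => k; exact: h_sampled.
Qed.

(** Splitting on the value of [tau] gives a finite sum with one indicator per time. Almost surely
    the gradients may be replaced by [h], and the resulting bounded factors [phi t] depend on the
    samples alone. *)
Lemma expectation_tau :
  ('E_P[fun w => (enorm (gradient f (x (tau w) w)) `^ (4 / 3))%R])%E =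
  (T%:R^-1 * \sum_(1 <= t < T.+1) mean P (phi t))%:E.
Proof.
pose I t w : R := \1_(tau @^-1` [set t]) w.
have mI t : measurable_fun setT (I t) by exact: measurable_indic.
pose Psi w := \sum_(1 <= t < T.+1) phi t w * I t w.
pose Phi w := \sum_(1 <= t < T.+1) enorm (gradient f (x t w)) `^ (4 / 3) * I t w.
have PhiE w : enorm (gradient f (x (tau w) w)) `^ (4 / 3) = Phi w.
  rewrite /Phi (sum_nat_pick (fun t => enorm (gradient f (x t w)) `^ (4 / 3)) (tau_range w)) //.
    by rewrite /I indicE mem_set.
  move=> t tw; rewrite /I indicE memNset //= => tE.
  by move: tw; rewrite tE eqxx.
have mphi t : (1 <= t <= T)%N -> measurable_fun setT (phi t).
  by move=> tT; exact: (submeasurable_measurable samples_meas (phi_sampled tT)).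
have LI t : L1 P (I t) by apply: (L1_bounded P _ (norm_indic_le1 _)).
have LphiI t : (1 <= t <= T)%N -> L1 P (fun w => phi t w * I t w).
  by move=> tT; apply: (L1M (mphi t tT) (phi_bound t)).
have LPsi : L1 P Psi by rewrite /Psi; under eq_fun do rewrite big_nat; exact: L1_sum.
have mPhi : measurable_fun setT Phi.
  apply: measurable_sum_nat => t tT; apply: measurable_funM => //.
  apply: (measurableT_comp (measurable_powR _)); apply: measurable_enorm => k.
  exact: L1_measurable (grad_L1 k tT).
rewrite unlock; under eq_integral do rewrite PhiE.
have PhiPsi : {ae P, forall w, Phi w = Psi w}.
  apply: filterS h_eq_grad => w hw.
  have hE t : (1 <= t <= T)%N -> gradient f (x t w) = h t w.
    by move=> tT; apply/rowP => k; rewrite -hw.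
  have phiE t : (1 <= t <= T)%N -> enorm (gradient f (x t w)) `^ (4 / 3) = phi t w.
    by move=> tT; rewrite hE.
  rewrite /Phi /Psi big_nat [RHS]big_nat; apply: eq_bigr => t tT.
  by rewrite (phiE t tT).
rewrite (ae_eq_integral_EFin mPhi (L1_measurable LPsi) PhiPsi) (integral_mean LPsi).
congr EFin; rewrite /Psi.
under [X in mean P X]eq_fun do rewrite big_nat.
rewrite mean_sum // mulr_sumr [RHS]big_nat; apply: eq_bigr => t tT.
exact: mean_tau (phi_sampled tT) (phi_bound t).
Qed.

Lemma adausm_rate :
  (poweR 'E_P[fun w => (enorm (gradient f (x (tau w) w)) `^ (4 / 3))%R] (3 / 2)
     <= (adausm_bound Delta eta eps mu lambda sigma L a n T)%:E)%E.
Proof.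
have L0 : 0 <= L := lipschitz_ge0 f_smooth hn.
have D0 : 0 <= Delta by rewrite subr_ge0; apply: ge_inf => //; exists x1.
have mu1 : 0 < 1 - mu by rewrite subr_gt0.
have K0 : 0 <= K.
  rewrite /K divr_ge0 //; first by rewrite mulr_ge0 // addr_ge0.
  by rewrite mulr_ge0 // sqr_ge0.
have C1_ge := adausm_C1_ge eta_gt0 mu_ge0 mu_lt1 lambda_ge0 lambda_le D0.
have C2_ge := adausm_C2_ge eta_gt0 mu_ge0 mu_lt1 lambda_ge0 sigma_ge0 n L0.
rewrite expectation_tau poweR_EFin lee_fin.
(* The decorrelation divides by [sigma]. For [sigma = 0] the truncated gradients and the logarithm
   both vanish, and nonnegativity of [adausm_C1] is enough. *)
move: (sigma_ge0); rewrite le_eqVlt => /predU1P[s0|s0].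
  have phi0 t w : phi t w = 0.
    have e0 : enorm (h t w) = 0.
      rewrite /enorm big1 ?sqrtr0 // => k _.
      by have := h_bounded t k w; rewrite -s0 normr_le0 => /eqP ->; rewrite expr0n.
    by rewrite /phi e0 powR0 // gt_eqF.
  rewrite big1 => [|t _]; last first.
    by rewrite -[RHS](mean_cst P 0); apply: eq_Rintegral => w _; rewrite phi0.
  have lnE : ln (1 + sigma ^+ 2 / eps ^+ 2 * \sum_(1 <= t < T.+1) a t) = 0.
    by rewrite -s0 expr0n mul0r mul0r addr0 ln1.
  rewrite mulr0 powR0 ?gt_eqF // /adausm_bound lnE mulr0 addr0.
  apply: mulr_ge0; first by rewrite divr_ge0 ?sqrtr_ge0.
  apply: le_trans C1_ge; rewrite divr_ge0 ?(ltW eta_gt0) //.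
  by rewrite mulr_ge0 // mulr_ge0 // ltW.
have h_bounded' t k w : (1 <= t <= T)%N -> `|h t w ord0 k| <= sigma by [].
have desc : {ae P, forall w, \sum_(1 <= t < T.+1) \sum_(k < n)
    h t w ord0 k * (adausm_step eta eps a (fun i => g i w) t k * g t w ord0 k) <=
  (1 - mu) * Delta + K * \sum_(1 <= t < T.+1) \sum_(k < n)
    (adausm_step eta eps a (fun i => g i w) t k * g t w ord0 k) ^+ 2}.
  apply: filterS h_eq_grad => w hw; apply: le_trans (run_descent w).
  rewrite !big_nat le_eqVlt; apply/orP; left; apply/eqP.
  by apply: eq_bigr => t tT; apply: eq_bigr => k _; rewrite hw.
have sumB := sum_mean_grad_le eps_gt0 s0 a_norm a_nondec past_meas g_adapted h_adapted
  h_bounded' g_L1 g2_L1 g_mean g_second eta_gt0 K0 desc.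
have := average_powR_le eps_gt0 s0 a_norm a_nondec past_meas g_adapted h_adapted
  h_bounded' g2_L1 g_second T_gt0 sumB.
move=> /le_trans; apply; rewrite /adausm_bound.
apply: ler_wpM2l; first by rewrite divr_ge0 ?sqrtr_ge0.
have lnA : 0 <= ln (log_argument T a eps sigma).
  rewrite ln_ge0 // lerDl mulr_ge0 ?divr_ge0 ?sqr_ge0 //.
  by apply: le_trans (sum_weight_ge a_norm a_nondec T).
have := ler_wpM2r lnA C2_ge.
rewrite -/(log_argument T a eps sigma) -/K.
move: (ln _) => l hl.
have -> : 2 * ((1 - mu) * Delta / eta + (K * eta + sigma) * (n%:R * l)) =
  2 * (1 - mu) * Delta / eta + 2 * (K * eta + sigma) * n%:R * l by ring.
exact: lerD.
Qed.

End adausm_analysis.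

Theorem theorem1 (R : realType)
    (* objective *)
    (n : nat) (hn : (0 < n)%N)
    (f : 'rV[R]_n -> R^o) (L : R)
    (f_diff : forall y, differentiable f y)
    (f_smooth : forall y z : 'rV[R]_n,
       enorm (gradient f y - gradient f z) <= L * enorm (y - z))
    (f_lb : has_lbound (range f))
    (* parameters and weights *)
    (eta eps mu lambda sigma : R) (a : nat -> R) (T : nat)
    (eta_gt0 : 0 < eta) (eps_gt0 : 0 < eps) (mu_ge0 : 0 <= mu) (mu_lt1 : mu < 1)
    (lambda_ge0 : 0 <= lambda) (lambda_le : lambda <= 1 / (1 - mu))
    (sigma_ge0 : 0 <= sigma)
    (a_gt0 : forall t, (1 <= t)%N -> 0 < a t)
    (a_nondec : forall s t, (1 <= s)%N -> (s <= t)%N -> a s <= a t)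
    (* normalization of the weights; the iterates depend only on a_t / a_1 *)
    (a_norm : 1 <= a 1%N)
    (T_gt0 : (0 < T)%N)
    (* probability space, samples, stochastic gradients, output index *)
    (d : measure_display) (Omega : measurableType d) (P : probability Omega R)
    (d' : measure_display) (Xi : measurableType d')
    (xi : nat -> Omega -> Xi)
    (xi_meas : forall t, (1 <= t)%N -> measurable_fun setT (xi t))
    (xi_indep : mutually_independent P [set t | (1 <= t)%N] xi)
    (G : nat -> 'rV[R]_n * Xi -> 'rV[R]_n)
    (G_meas : forall t, (1 <= t <= T)%N -> measurable_fun setT (G t))
    (tau : Omega -> nat)
    (tau_meas : measurable_fun setT tau)
    (tau_range : forall w, (1 <= tau w <= T)%N)
    (tau_unif : forall t, (1 <= t <= T)%N ->
       P (tau @^-1` [set t]) = (T%:R^-1)%:E)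
    (tau_indep : independent_systems P (sigma_of tau)
       (sigma_family [set t | (1 <= t)%N] xi))
    (* the run of the algorithm *)
    (x1 : 'rV[R]_n) (g m x : nat -> Omega -> 'rV[R]_n)
    (g_sample : forall t w, (1 <= t <= T)%N -> g t w = G t (x t w, xi t w))
    (run : forall w, adausm_run eta eps mu lambda a x1 T
       (fun t => g t w) (fun t => m t w) (fun t => x t w))
    (A1 : forall t (k : 'I_n), (1 <= t <= T)%N ->
       cond_expectation P (sigma_family [set i | (1 <= i < t)%N] g)
         (fun w => g t w ord0 k) (fun w => gradient f (x t w) ord0 k))
    (A2 : forall t, (1 <= t <= T)%N ->
       exists Y : Omega -> R,
         cond_expectation P (sigma_family [set i | (1 <= i < t)%N] g)
           (fun w => enorm (g t w) ^+ 2) Y /\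
         {ae P, forall w, Y w <= sigma ^+ 2}) :
  let Delta := f x1 - inf (range f) in
  let Bound := adausm_bound Delta eta eps mu lambda sigma L a in
  (poweR 'E_P[fun w => (enorm (gradient f (x (tau w) w)) `^ (4 / 3))%R] (3 / 2)
     <= (Bound n T)%:E)%E /\
  (* Bound = O (dim * log (sum of weights) / sqrt T) as T goes to infinity,
     with a constant independent of the dimension as well *)
  (exists K : R, \forall T' \near \oo, forall n' : nat, (0 < n')%N ->
     `|Bound n' T'| <=
       K * `|n'%:R * ln (\sum_(1 <= t < T'.+1) a t) / Num.sqrt T'%:R|).
Proof.
move=> Delta Bound; split; last first.
  by apply: adausm_bound_bigO.
exact: (adausm_rate hn f_diff f_smooth f_lb eta_gt0 eps_gt0 mu_ge0 mu_lt1 lambda_ge0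
  lambda_le sigma_ge0 a_nondec a_norm T_gt0 xi_meas G_meas tau_meas tau_range tau_unif
  tau_indep g_sample run A1 A2).
Qed.
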